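(* Let $q=p^e$ be a power of a prime $p$, let $d\geq 3$ be an odd integer with $q\equiv 1 \pmod{2d(d-1)}$, and let $a,b\in\mathbb{F}_q^\times$. Let $N_d=\#\{(x,y)\in\mathbb{F}_q^2 : y^2=x^d+ax+b\}$. Let $T$ be a fixed generator of $\widehat{\mathbb{F}_q^\times}$, and put $\psi=T^{\frac{q-1}{2(d-1)}}$ (order $2(d-1)$) and $\xi=T^{\frac{q-1}{2d(d-1)}}$ (order $2d(d-1)$). Let $\alpha=\dfrac{d}{a}\left(\dfrac{db}{a(d-1)}\right)^{d-1}$. Then $$N_d=q+\phi(b)-\phi(-b(d-1))\,T^{\frac{q-1}{4}}(-1)+q^{\frac{d-1}{2}}\phi(-b(d-1))\,T^{\frac{q-1}{4}}(-1)\,T^{\frac{q-1}{2(d-1)}}\!\left(-\frac1\alpha\right)\,{}_{d-1}F_{d-2}\!\left(\begin{array}{c}A_0,A_1,\ldots,A_{d-2}\\ B_1,\ldots,B_{d-2}\end{array}\Big|\ -\alpha\right),$$ where $A_0=\xi^{d-2}$ and, for $k=2,\ldots,d-1$, $A_{k-1}=\xi^{2k(d-1)-d}$ and $B_{k-1}=\psi^{2k-2}$; i.e. the top row is $\xi^{d-2},\xi^{3d-4},\ldots,\xi^{d^2-3d+1},\xi^{d^2-d-1},\ldots,\xi^{2d^2-5d+2}$ and the bottom row is $\psi^2,\psi^4,\ldots,\psi^{2d-4}$.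
   Context: $\widehat{\mathbb{F}_q^\times}$ denotes the group of multiplicative characters of $\mathbb{F}_q^\times$; every character (including the trivial one) is extended to $\mathbb{F}_q$ by setting $\chi(0)=0$. $\varepsilon$ is the trivial character and $\phi$ the quadratic character. For characters $A,B$, $\overline{B}$ is the inverse of $B$ and $${A\choose B}:=\frac{B(-1)}{q}\sum_{x\in\mathbb{F}_q}A(x)\overline{B}(1-x).$$ For characters $A_0,\ldots,A_n,B_1,\ldots,B_n$ and $x\in\mathbb{F}_q$, the Gaussian hypergeometric series is $${}_{n+1}F_n\!\left(\begin{array}{c}A_0,A_1,\ldots,A_n\\ B_1,\ldots,B_n\end{array}\Big|\ x\right):=\frac{q}{q-1}\sum_{\chi}{A_0\chi\choose\chi}{A_1\chi\choose B_1\chi}\cdots{A_n\chi\choose B_n\chi}\chi(x),$$ the sum over all multiplicative characters $\chi$ of $\mathbb{F}_q$. *)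

(* Defs.v *)
From HB Require Import structures.
From mathcomp Require Import all_boot all_order all_algebra all_fingroup all_solvable all_field all_character.
Set Implicit Arguments. Unset Strict Implicit. Unset Printing Implicit Defensive.
Import Order.TTheory GRing.Theory Num.Theory.
Local Open Scope ring_scope.

(* Multiplicative characters of F_q^x are the (linear = irreducible) characters
   of the abelian finite group {unit F}; they live in 'CF(UG F). *)
Definition UG (F : finFieldType) := [set: {unit F}]%G.

Definition ext (F : finFieldType) (chi : 'CF(UG F)) (x : F) : algC :=
  if insub x is Some u then chi u else 0.

Definition qchar (F : finFieldType) (x : F) : algC :=
  if x == 0 then 0 else if [exists y : F, y ^+ 2 == x] then 1 else -1.

Definition gbinom (F : finFieldType) (A B : 'CF(UG F)) : algC :=
  ext B (-1) / (#|F|%:R) * \sum_(x : F) ext A x * ext (B^-1) (1 - x).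

Definition ghyp (F : finFieldType) (n : nat) (A B : nat -> 'CF(UG F)) (x : F)
  : algC :=
  (#|F|%:R / (#|F|.-1)%:R) *
  \sum_(i : Iirr (UG F))
     (gbinom (A 0%N * 'chi_i) 'chi_i *
      \prod_(1 <= k < n.+1) gbinom (A k * 'chi_i) (B k * 'chi_i)) * ext 'chi_i x.

Definition Npts (F : finFieldType) (d : nat) (a b : F) : nat :=
  #|[set xy : F * F | xy.2 ^+ 2 == xy.1 ^+ d + a * xy.1 + b]|.

(* Main.v *)
(** Writing the number of points as q plus a sum of quadratic characters and
    expanding that sum over the multiplicative characters chi turns it into a sum
    of products of three Gauss sums, g(phi chi^(1-d)) g(chi^d) g(chi^-1).  The
    product formula of Hasse and Davenport for m = d and m = d - 1 splits
    g(chi^d) and g(phi chi^(1-d)) into products over the characters of order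
    dividing d and d - 1; paired off, these are the Jacobi sums in the
    hypergeometric series.  The trivial chi is exceptional, since its Gauss sum
    has absolute value 1 instead of the square root of q, and it accounts for
    the correction term.

    The Hasse-Davenport formula comes from the L-functions sum_f lambda(f) T^(deg f)
    over monic polynomials f, with
    lambda(f) = chi(product of the roots) theta(sum of the m-th powers of the roots).
    The recursion n c_n = sum_(1 <= j <= n) S_j c_(n-j) ties the coefficients c_n to
    the sums S_j of lambda over the characteristic polynomials of the elements of
    F_(q^j).  For m = 1 the L-function is 1 + g(chi) T, hence S_j = - (- g(chi))^j.
    For general m and with chi^m in place of chi, counting m-th roots in F_(q^j)
    shows that S_j is the sum of the S_j attached to the m twists of chi by
    characters of order dividing m, so c_m is the product of their Gauss sums;
    on the other hand the m-th power sum is affine in the constant term of a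
    polynomial of degree m, so c_m is g(chi^m) chi(m)^(-m) times a factor that does
    not depend on chi. *)

Require Import Defs.
From HB Require Import structures.
From mathcomp Require Import all_boot all_order all_algebra all_fingroup all_solvable all_field all_character.
From mathcomp Require Import zify ring.
Set Implicit Arguments. Unset Strict Implicit. Unset Printing Implicit Defensive.
Import Order.TTheory GRing.Theory Num.Theory.
Local Open Scope ring_scope.

(** * Newton's identities *)

Section Newton.
Variable R : comNzRingType.
Implicit Types rs ss : seq R.

Definition psum rs n := \sum_(r <- rs) r ^+ n.
(** The signed elementary symmetric polynomial $(-1)^n e_n$ of the roots. Reading it off the
    reversed polynomial makes it 0 once [n] exceeds the number of roots. *)
Definition esgn rs n : R := (\prod_(r <- rs) (1 - r *: 'X))`_n.

Lemma esgn_cons r rs n : esgn (r :: rs) n.+1 = esgn rs n.+1 - r * esgn rs n.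
Proof. by rewrite /esgn big_cons mulrBl mul1r coefB -scalerAl coefZ coefXM. Qed.

Lemma esgn_cons0 r rs : esgn (r :: rs) 0 = esgn rs 0.
Proof.
by rewrite /esgn big_cons mulrBl mul1r coefB -scalerAl coefZ coefXM /= mulr0 subr0.
Qed.

Lemma esgn0 rs : esgn rs 0 = 1.
Proof.
by elim: rs => [|r rs IH]; rewrite ?esgn_cons0 // /esgn big_nil coef1.
Qed.

Lemma esgn_gt rs n : (size rs < n)%N -> esgn rs n = 0.
Proof.
elim: rs n => [|r rs IH] [|n] //= hn; first by rewrite /esgn big_nil coef1.
by rewrite esgn_cons !IH ?mulr0 ?subr0 // ltnW.
Qed.

(** Induction on the list: a new root [r] multiplies the generating polynomial by $1 - rX$, and the
    extra terms in powers of [r] telescope. *)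
Lemma newton_psum rs n :
  n%:R * esgn rs n = - \sum_(1 <= j < n.+1) psum rs j * esgn rs (n - j).
Proof.
elim: rs n => [|r rs IH] n.
  rewrite big1 => [|j _]; last by rewrite /psum big_nil mul0r.
  rewrite oppr0 /esgn big_nil coef1; case: n => [|n]; by rewrite ?mul0r ?mulr0.
case: n => [|n]; first by rewrite mul0r big_geq ?oppr0.
have psumE j : psum (r :: rs) j = r ^+ j + psum rs j by rewrite /psum big_cons.
have step j : (j <= n)%N ->
    esgn (r :: rs) (n.+1 - j) = esgn rs (n.+1 - j) - r * esgn rs (n - j).
  by move=> jn; rewrite subSn // esgn_cons.
rewrite big_nat_recr //= subnn esgn_cons0.
rewrite (eq_big_nat _ _ (F2 := fun j => psum rs j * esgn rs (n.+1 - j)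
   - r * (psum rs j * esgn rs (n - j))
   + (r ^+ j * esgn rs (n.+1 - j) - r ^+ j.+1 * esgn rs (n - j)))); last first.
  move=> j /andP[_ jn]; rewrite step // psumE exprS; ring.
rewrite big_split sumrB -mulr_sumr /=.
have tele : \sum_(1 <= j < n.+1)
    (r ^+ j * esgn rs (n.+1 - j) - r ^+ j.+1 * esgn rs (n - j))
    = r * esgn rs n - r ^+ n.+1 * esgn rs 0.
  rewrite -[X in _ = X]opprB.
  have := @telescope_sumr _ 1 n.+1 (fun j => r ^+ j * esgn rs (n.+1 - j)) (ltn0Sn n).
  rewrite subnn expr1 subSS subn0 => <-.
  rewrite -sumrN; apply: eq_big_nat => j /andP[_ jn].
  by rewrite opprB subSS.
have e1 := IH n.+1; have e2 := IH n.
rewrite big_nat_recr //= subnn in e1.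
rewrite tele esgn_cons psumE esgn0 in e1 *.
move: e1 e2; set S1 := \sum_(1 <= j < n.+1) _; set S2 := \sum_(1 <= j < n.+1) _.
move=> e1 e2.
have -> : S2 = - (n%:R * esgn rs n) by rewrite e2 opprK.
have -> : S1 = - (n.+1%:R * esgn rs n.+1) - psum rs n.+1 * 1.
  by rewrite e1; ring.
by rewrite -!natr1; ring.
Qed.

Lemma coef_prod_XsubC_esgn rs n : (n <= size rs)%N ->
  (\prod_(r <- rs) ('X - r%:P))`_(size rs - n) = esgn rs n.
Proof.
elim: rs n => [|r rs IH] [|n] //= hn.
- by rewrite big_nil coef1 esgn0.
- rewrite subn0 big_cons mulrBl coefB coefXM coefCM /= esgn0.
  have := IH 0 isT; rewrite subn0 esgn0 => ->.
  by rewrite nth_default ?mulr0 ?subr0 // size_prod_XsubC.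
rewrite big_cons mulrBl coefB coefXM coefCM subSS esgn_cons (IH n) //.
have [lt_n|ge_n] := ltnP n (size rs).
  rewrite subn_eq0 leqNgt lt_n /=; congr (_ - _).
  by rewrite -(IH n.+1) // subnS.
have -> : n = size rs by apply/eqP; rewrite eqn_leq ge_n -ltnS hn.
by rewrite subnn /= (esgn_gt (ltnSn _)).
Qed.

Lemma psum_rec rs n : psum rs n.+1 = - (n.+1%:R * esgn rs n.+1)
  - \sum_(1 <= j < n.+1) psum rs j * esgn rs (n.+1 - j).
Proof. by rewrite newton_psum big_nat_recr //= subnn esgn0; ring. Qed.

Lemma eq_psum rs ss m : (forall n, (n < m)%N -> esgn rs n = esgn ss n) ->
  forall n, (0 < n < m)%N -> psum rs n = psum ss n.
Proof.
move=> eq_e n; elim/ltn_ind: n => -[//|n] IH /= lt_nm.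
rewrite !psum_rec eq_e //; congr (_ - _); apply: eq_big_nat => j /andP[j0 jn].
rewrite IH // ?j0 ?(ltn_trans jn) // eq_e //.
by rewrite (leq_ltn_trans _ lt_nm) // leq_subr.
Qed.

(** In the recursion for [psum rs m.+1] the top coefficient occurs only in [m.+1%:R * esgn rs m.+1].
    For a polynomial of degree [m.+1] this makes the power sum affine in the constant term. *)
Lemma psum_esgn_top rs ss m : (forall n, (n < m.+1)%N -> esgn rs n = esgn ss n) ->
  psum rs m.+1 = psum ss m.+1 - m.+1%:R * (esgn rs m.+1 - esgn ss m.+1).
Proof.
move=> eq_e; rewrite !psum_rec.
have -> : \sum_(1 <= j < m.+1) psum rs j * esgn rs (m.+1 - j) =
          \sum_(1 <= j < m.+1) psum ss j * esgn ss (m.+1 - j).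
  apply: eq_big_nat => j /andP[j0 jm].
  by rewrite (eq_psum eq_e) ?j0 // eq_e // ltn_subrL j0.
ring.
Qed.

End Newton.

(** In characteristic 0 the factor [n] cancels, so the recursion determines its solution. This
    identifies the coefficients of an L-function once the sums $S_j$ are known to be negated power
    sums. *)
Lemma newton_unique (R : numDomainType) (rs : seq R) (c : nat -> R) M :
    c 0%N = 1 ->
    (forall n, (n <= M)%N ->
       n%:R * c n = - \sum_(1 <= j < n.+1) psum rs j * c (n - j)%N) ->
  forall n, (n <= M)%N -> c n = esgn rs n.
Proof.
move=> c0 rec; elim/ltn_ind => -[|n] IH le_nM; first by rewrite c0 esgn0.
apply: (@mulfI _ n.+1%:R); first by rewrite pnatr_eq0.
rewrite rec // newton_psum; congr (- _); apply: eq_big_nat => j /andP[j0 jn].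
by rewrite IH ?ltn_subrL ?j0 // (leq_trans (leq_subr _ _)).
Qed.

(** * Frobenius orbits and L-functions *)

Section FrobeniusOrbits.
Variables (F K : finFieldType) (iota : {rmorphism F -> K}) (ell : K -> F).
Hypothesis ellK : cancel iota ell.

Local Notation q := #|F|.
Local Notation "f ^i" := (map_poly iota f) (at level 2, format "f ^i").

Lemma card_pchar_nat : [pchar K].-nat q.
Proof.
have [p pr_p pcharFp] := finPcharP F.
have pK : p \in [pchar K] by rewrite (fmorph_pchar iota).
rewrite (eq_pnat _ (pcharf_eq pK)) -cardsT.
by have /and3P[] := fin_ring_pchar_abelem pcharFp.
Qed.

Definition frobenius (x : K) := x ^+ q.

Fact frobenius_is_additive : {morph frobenius : x y / x + y}.
Proof. by move=> x y; rewrite /frobenius exprDn_pchar // card_pchar_nat. Qed.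

Fact frobenius_is_zmod : zmod_morphism frobenius.
Proof.
move=> x y; apply: (addIr (frobenius y)).
by rewrite -frobenius_is_additive !subrK.
Qed.

Fact frobenius_is_monoid : monoid_morphism frobenius.
Proof. by split=> [|x y]; rewrite /frobenius ?expr1n ?exprMn. Qed.

HB.instance Definition _ :=
  GRing.isZmodMorphism.Build K K frobenius frobenius_is_zmod.
HB.instance Definition _ :=
  GRing.isMonoidMorphism.Build K K frobenius frobenius_is_monoid.

(** $X^q - X$ is the product of all $X - y$ with $y$ in [F]. The factorization persists over [K], so
    its roots there come from [F]. *)
Lemma frobenius_fixed x : x ^+ q = x -> iota (ell x) = x.
Proof.
move=> xq; suff /existsP[y /eqP <-] : [exists y, iota y == x] by rewrite ellK.
have := congr1 (fun f => f^i.[x]) (finField_genPoly F).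
rewrite rmorphB /= map_polyXn map_polyX !hornerE xq subrr rmorph_prod.
rewrite horner_prod => /esym/eqP; rewrite prodf_seq_eq0 => /hasP[y _].
rewrite /= map_polyXsubC hornerXsubC subr_eq0 => /eqP xy.
by apply/existsP; exists y; rewrite xy.
Qed.

(** The field with $q^j$ elements is encoded by the condition [y ^+ (q ^ j) = y] inside [K]. For
    such [y] this is the characteristic polynomial over [F], a power of the minimal one. *)
Definition orbit_poly (y : K) j := \prod_(i < j) ('X - (y ^+ (q ^ i))%:P).
Definition char_poly_at j (y : K) : {poly F} := map_poly ell (orbit_poly y j).

(** Frobenius permutes the factors of [orbit_poly y j] cyclically, hence fixes the coefficients,
    which therefore lie in the image of [F], where [ell] inverts [iota]. *)
Lemma map_char_poly_at j y : y ^+ (q ^ j) = y ->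
  (char_poly_at j y)^i = orbit_poly y j.
Proof.
move=> yj; have ell0 : ell 0 = 0 by rewrite -(rmorph0 iota) ellK.
have orbF : map_poly frobenius (orbit_poly y j) = orbit_poly y j.
  rewrite /orbit_poly map_prod_XsubC /= /frobenius.
  case: j yj => [|j] yj; first by rewrite !big_ord0.
  rewrite big_ord_recr big_ord_recl /= mulrC -exprM -expnSr yj expn0 expr1.
  by congr (_ * _); apply: eq_bigr => i _; rewrite -exprM -expnSr.
apply/polyP => k; rewrite coef_map coef_map_id0 //; apply: frobenius_fixed.
by rewrite -[RHS](congr1 (fun f : {poly K} => f`_k) orbF) coef_map.
Qed.

Lemma orbit_poly_monic y j : orbit_poly y j \is monic.
Proof. exact: monic_prod_XsubC. Qed.

Lemma size_orbit_poly y j : size (orbit_poly y j) = j.+1.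
Proof. by rewrite /orbit_poly size_prod_XsubC /index_enum -enumT size_enum_ord. Qed.

Lemma char_poly_at_monic j y : y ^+ (q ^ j) = y -> char_poly_at j y \is monic.
Proof. by move/map_char_poly_at=> e; rewrite -(map_monic iota) e orbit_poly_monic. Qed.

Lemma size_char_poly_at j y : y ^+ (q ^ j) = y -> size (char_poly_at j y) = j.+1.
Proof. by move/map_char_poly_at=> e; rewrite -(size_map_poly iota) e size_orbit_poly. Qed.

Lemma root_frobenius (f : {poly F}) y : root f^i y -> root f^i (y ^+ q).
Proof.
move=> /rootP fy; apply/rootP.
have -> : f^i = map_poly frobenius f^i.
  rewrite -map_poly_comp; apply: eq_map_poly => x /=.
  by rewrite /frobenius -rmorphXn expf_card.
by rewrite -[y ^+ q]/(frobenius y) horner_map fy rmorph0.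
Qed.

Lemma root_frobenius_iter (f : {poly F}) y i : root f^i y -> root f^i (y ^+ (q ^ i)).
Proof.
move=> fy; elim: i => [|i IH]; first by rewrite expr1.
by rewrite expnSr exprM root_frobenius.
Qed.

Lemma frobenius_iter_inj i : injective (fun y : K => y ^+ (q ^ i)).
Proof.
elim: i => [|i IH] x y; first by rewrite !expr1.
by rewrite expnSr !exprM => /(fmorph_inj frobenius)/IH.
Qed.

Lemma orbit_polyD y e j : y ^+ (q ^ e) = y ->
  orbit_poly y (e + j) = orbit_poly y e * orbit_poly y j.
Proof.
move=> ye; rewrite /orbit_poly big_split_ord /=; congr (_ * _).
by apply: eq_bigr => i _; rewrite expnD exprM ye.
Qed.

(** The first [size f] Frobenius iterates of [y] are roots, one more than the degree allows, so two
    coincide and injectivity gives a period. Below the least period [e] the conjugates are distinct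
    roots, so their product divides. *)
Lemma root_period (f : {poly F}) y : f \is monic -> root f^i y ->
  exists e, [/\ (0 < e < size f)%N, y ^+ (q ^ e) = y,
    forall j, (0 < j < e)%N -> y ^+ (q ^ j) != y & orbit_poly y e %| f^i].
Proof.
move=> mf fy.
have [e0 /andP[/andP[e0gt0 e0lt] /eqP e0P]] :
    exists e0, (0 < e0 < size f)%N && (y ^+ (q ^ e0) == y).
  pose rs := mkseq (fun i => y ^+ (q ^ i)) (size f).
  have : ~~ uniq rs.
    apply/negP => U; have fi0 : f^i != 0 by rewrite map_poly_eq0 monic_neq0.
    have rsP : all (root f^i) rs.
      by apply/allP=> z /mapP[i _ ->]; apply: root_frobenius_iter.
    by have := max_poly_roots fi0 rsP U; rewrite size_map_poly size_mkseq ltnn.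
  case/(uniqPn 0) => i [j []]; rewrite size_mkseq => ij jf.
  rewrite !nth_mkseq ?(ltn_trans ij) // => eij.
  exists (j - i)%N; rewrite subn_gt0 ij (leq_ltn_trans (leq_subr _ _)) //=.
  apply/eqP/(@frobenius_iter_inj i) => /=.
  by rewrite -exprM -expnD subnK 1?ltnW.
have exP : exists e, (0 < e)%N && (y ^+ (q ^ e) == y).
  by exists e0; rewrite e0gt0 e0P eqxx.
have [e /andP[egt0 /eqP eP] emin] := ex_minnP exP.
have ele : (e <= e0)%N by apply: emin; rewrite e0gt0 e0P eqxx.
exists e; split=> //.
- by rewrite egt0 (leq_ltn_trans ele).
- move=> j /andP[j0 je]; apply: contraTN je => yj; rewrite -leqNgt emin //.
  by rewrite j0 yj.
rewrite /orbit_poly -(big_mkord xpredT (fun i => 'X - (y ^+ (q ^ i))%:P)).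
rewrite -(big_map (fun i => y ^+ (q ^ i)) xpredT (fun z => 'X - z%:P)).
apply: uniq_roots_dvdp.
  by apply/allP=> z /mapP[i _ ->]; apply: root_frobenius_iter.
rewrite uniq_rootsE map_inj_in_uniq ?iota_uniq // => i j.
rewrite !mem_index_iota /= => ie je.
wlog ij : i j ie je / (i <= j)%N => [hw|].
  by case/orP: (leq_total i j) => ? ?; [|symmetry]; apply: hw.
move=> eij; apply/eqP; rewrite eqn_leq ij -subn_eq0.
rewrite -leqn0 leqNgt; apply/negP => gt0.
have := emin (j - i)%N; rewrite gt0 /=.
have -> : y ^+ (q ^ (j - i)) == y.
  apply/eqP/(@frobenius_iter_inj i) => /=.
  by rewrite -exprM -expnD subnK.
by move=> /(_ isT); lia.
Qed.

(* Splitting off the minimal-period factor of y lowers both sides by one. *)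
Lemma count_orbit_poly_dvd (f : {poly F}) y : f \is monic ->
  (\sum_(1 <= j < size f) ((y ^+ (q ^ j)%N == y) && (orbit_poly y j %| f^i))%R)%N
    = mup y f^i.
Proof.
have [n] := ubnP (size f); elim: n f => // n IH f szf mf.
have [fy|nfy] := boolP (root f^i y); last first.
  rewrite mupNroot // big1_seq // => j /andP[_]; rewrite mem_index_iota.
  move=> /andP[j0 _]; case: andP => // -[_ dv]; case/negP: nfy.
  rewrite -dvdp_XsubCl; apply: dvdp_trans dv.
  by case: j j0 => // j _; rewrite /orbit_poly big_ord_recl expn0 expr1 dvdp_mulr.
have [e [/andP[e0 ef] ye emin dv]] := root_period mf fy.
have fE : f = char_poly_at e y * (f %/ char_poly_at e y).
  by apply/eqP; rewrite mulrC -dvdp_eq -(dvdp_map iota) map_char_poly_at.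
set g := f %/ _ in fE.
have mc := char_poly_at_monic ye.
have mg : g \is monic by rewrite -(monicMl _ mc) -fE.
have szE : size f = (e + size g)%N.
  by rewrite fE size_monicM ?monic_neq0 // size_char_poly_at.
have gi0 : g^i != 0 by rewrite map_poly_eq0 monic_neq0.
have fiE : f^i = orbit_poly y e * g^i by rewrite {1}fE rmorphM /= map_char_poly_at.
have sg : (0 < size g)%N by rewrite size_poly_gt0 monic_neq0.
(* No [j] below the period [e] contributes, [j = e] contributes 1, and [j + e] contributes for [f]
   what [j] contributes for [g]. *)
rewrite (big_cat_nat _ (n := e)) //=; last by rewrite ltnW.
rewrite big1_seq ?add0n => [|j /andP[_]]; last first.
  by rewrite mem_index_iota => jj; rewrite (negbTE (emin j jj)).
rewrite big_ltn // ye eqxx dv /= fiE mupM //; last first.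
  by rewrite monic_neq0 ?orbit_poly_monic.
have szg : (size g < n)%N by move: szf; rewrite szE; clear -e0; lia.
rewrite -(IH g) //.
congr (_ + _)%N.
  have -> : mup y (orbit_poly y e) = 1%N; last by [].
  rewrite /orbit_poly; case: e e0 {ef ye fE dv g mc mg szE gi0 fiE sg szg} emin => // e _ emin.
  rewrite big_ord_recl expn0 expr1 mupMl.
    by rewrite -[X in mup _ X]expr1 mup_XsubCX eqxx.
  rewrite rootE horner_prod; apply/prodf_neq0 => i _.
  by rewrite hornerXsubC subr_eq0 eq_sym emin //= ltnS.
have -> : size f = (size g + e)%N by rewrite addnC.
rewrite -add1n big_addn addnK; apply: eq_big_nat => j _.
rewrite addnC expnD exprM ye orbit_polyD //.
by rewrite dvdp_mul2l // monic_neq0 ?orbit_poly_monic.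
Qed.

End FrobeniusOrbits.

Lemma sum_mup_prod_XsubC (K : finFieldType) (rs : seq K) :
  (\sum_y mup y (\prod_(r <- rs) ('X - r%:P)))%N = size rs.
Proof.
under eq_bigr => y _ do rewrite mu_prod_XsubC.
elim: rs => [|r rs IH] /=; first by rewrite big1.
rewrite big_split IH (bigD1 r) //= eqxx big1 // => y /negbTE.
by rewrite eq_sym => ->.
Qed.

(** * Sums over monic polynomials of fixed degree *)

Section MonicSums.
Variable F : finFieldType.

(** Indexing monic polynomials by their lower coefficients turns sums over them into sums over a
    finite type. *)
Definition monic_of n (c : 'rV[F]_n) : {poly F} := 'X^n + rVpoly c.

Lemma size_rVpoly n (c : 'rV[F]_n) : (size (rVpoly c) <= n)%N.
Proof. exact: size_poly. Qed.

Lemma size_monic_of n (c : 'rV[F]_n) : size (monic_of c) = n.+1.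
Proof. by rewrite size_polyDl size_polyXn // ltnS size_rVpoly. Qed.

Lemma monic_of_monic n (c : 'rV[F]_n) : monic_of c \is monic.
Proof.
rewrite monicE lead_coefDl ?lead_coefXn // size_polyXn ltnS.
exact: size_rVpoly.
Qed.

Lemma monic_of_inj n : injective (@monic_of n).
Proof. by move=> c d /addrI/(can_inj rVpolyK). Qed.

Lemma monic_ofK n (f : {poly F}) : f \is monic -> size f = n.+1 ->
  monic_of (poly_rV (f - 'X^n) : 'rV_n) = f.
Proof.
move=> mf szf; rewrite /monic_of poly_rV_K ?subrKC //.
apply/leq_sizeP => j; rewrite leq_eqVlt => /orP[/eqP <-|lt_nj].
  move: mf; rewrite monicE lead_coefE szf => /eqP /= fn.
  by rewrite coefB coefXn eqxx fn subrr.
by rewrite coefB coefXn gtn_eqF // subr0 nth_default ?szf.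
Qed.

(** The coefficient of $T^n$ in the L-function of [lam]. *)
Definition lcoef (lam : {poly F} -> algC) n := \sum_(c : 'rV[F]_n) lam (monic_of c).

Section Dvd.
Variable lam : {poly F} -> algC.
Hypothesis lamM : forall f g, f \is monic -> g \is monic ->
  lam (f * g) = lam f * lam g.

(** Multiplication by [P] is a bijection from the monic polynomials of degree [n - j] onto the
    multiples of [P] among those of degree [n]. *)
Lemma sum_monic_dvd n j (P : {poly F}) : P \is monic -> size P = j.+1 ->
  (j <= n)%N ->
  \sum_(c : 'rV[F]_n | P %| monic_of c) lam (monic_of c) = lam P * lcoef lam (n - j).
Proof.
move=> mP szP le_jn; have P0 := monic_neq0 mP.
have szM (c : 'rV[F]_(n - j)) : size (P * monic_of c) = n.+1.
  rewrite size_monicM ?monic_neq0 ?monic_of_monic // szP size_monic_of addSn /=.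
  by rewrite addnS subnKC.
have mM (c : 'rV[F]_(n - j)) : P * monic_of c \is monic.
  by rewrite monicMl // monic_of_monic.
pose h (c : 'rV[F]_(n - j)) : 'rV[F]_n := poly_rV (P * monic_of c - 'X^n).
have hE c : monic_of (h c) = P * monic_of c by apply: monic_ofK.
pose k (c : 'rV[F]_n) : 'rV[F]_(n - j) := poly_rV (monic_of c %/ P - 'X^(n - j)).
have kE c : P %| monic_of c -> monic_of c = P * monic_of (k c).
  move=> dv; have dE : monic_of c = P * (monic_of c %/ P).
    by apply/eqP; rewrite mulrC -dvdp_eq.
  have mq : monic_of c %/ P \is monic by rewrite -(monicMl _ mP) -dE monic_of_monic.
  rewrite {1}dE monic_ofK //; have := size_monic_of c.
  rewrite {1}dE size_monicM ?monic_neq0 // szP addSn /=.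
  by move: (size _); clear -le_jn; lia.
rewrite /lcoef mulr_sumr (reindex h); last first.
  exists k => c; rewrite !inE => hc.
    by apply: monic_of_inj; apply: (mulfI P0); rewrite -kE // hE dvdp_mulr.
  by apply: monic_of_inj; rewrite hE -kE.
apply: eq_big => [c|c _]; first by rewrite hE dvdp_mulr.
by rewrite hE lamM ?monic_of_monic.
Qed.
End Dvd.
End MonicSums.

(** * The Newton recursion for an L-function *)

Section LfunctionNewton.
Variables (F K : finFieldType) (iota : {rmorphism F -> K}) (ell : K -> F).
Hypothesis ellK : cancel iota ell.
Variable B : nat.
Hypothesis splits : forall f : {poly F}, f \is monic -> (size f <= B.+1)%N ->
  exists rs : seq K, map_poly iota f = \prod_(r <- rs) ('X - r%:P).
Variable lam : {poly F} -> algC.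
Hypothesis lamM : forall f g, f \is monic -> g \is monic ->
  lam (f * g) = lam f * lam g.

Definition frob_sum j :=
  \sum_(y : K | y ^+ (#|F| ^ j) == y) lam (char_poly_at ell j y).

(** A monic polynomial of degree [n] has [n] roots with multiplicity; by [count_orbit_poly_dvd] this
    is the number of pairs [(y, j)] whose characteristic polynomial divides it. Exchanging the sums
    and splitting off that divisor gives the recursion, a logarithmic derivative in coefficients. *)
Lemma lcoef_newton n : (n <= B)%N ->
  n%:R * lcoef lam n = \sum_(1 <= j < n.+1) frob_sum j * lcoef lam (n - j).
Proof.
move=> le_nB.
have nE (c : 'rV[F]_n) : n%:R = \sum_(y : K) \sum_(1 <= j < n.+1)
    ((y ^+ (#|F| ^ j) == y) && (char_poly_at ell j y %| monic_of c))%:R :> algC.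
  have [|rs rsE] := splits (monic_of_monic c); first by rewrite size_monic_of ltnS.
  have szrs : n = size rs.
    by apply: succn_inj; rewrite -(size_prod_XsubC rs id) -rsE size_map_poly size_monic_of.
  rewrite [X in X%:R = _]szrs -sum_mup_prod_XsubC -rsE natr_sum; apply: eq_bigr => y _.
  rewrite -(count_orbit_poly_dvd ellK _ (monic_of_monic c)) size_monic_of natr_sum.
  apply: eq_bigr => j _; case: eqP => //= yj.
  by rewrite -(dvdp_map iota) map_char_poly_at.
rewrite /lcoef mulr_sumr.
under eq_bigr => c _ do rewrite {1}(nE c) mulr_suml.
rewrite exchange_big /=.
under eq_bigr => y _ do under eq_bigr => c _ do rewrite mulr_suml.
under eq_bigr => y _ do rewrite exchange_big /=.
rewrite exchange_big /=; apply: eq_big_nat => j /andP[j0 jn].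
rewrite mulr_suml [RHS]big_mkcond /=; apply: eq_bigr => y _.
case: eqP => yj /=; last by rewrite big1 // => c _; rewrite mul0r.
rewrite -(sum_monic_dvd lamM) ?(char_poly_at_monic ellK) ?(size_char_poly_at ellK) //.
by rewrite [RHS]big_mkcond /=; apply: eq_bigr => c _; case: ifP; rewrite ?mul1r ?mul0r.
Qed.

End LfunctionNewton.

Lemma finField_prim_root (F : finFieldType) :
  exists w : F, #|F|.-1.-primitive_root w.
Proof.
have N0 : (0 < #|F|.-1)%N by rewrite -subn1 subn_gt0 finNzRing_gt1.
pose rs := enum [pred x : F | x != 0].
have rsP : all #|F|.-1.-unity_root rs.
  apply/allP => x; rewrite mem_enum inE => x0; apply/unity_rootP.
  by apply: (mulfI x0); rewrite -exprS prednK ?(ltn_trans _ (finNzRing_gt1 F)) // expf_card mulr1.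
have szrs : (#|F|.-1 <= size rs)%N.
  by rewrite -cardE -(cardC1 (0 : F)); apply/eq_leq/eq_card => x; rewrite !inE.
by have /hasP[w _ wP] := has_prim_root N0 rsP (enum_uniq _) szrs; exists w.
Qed.

Lemma prim_root_dvdz (R : fieldType) n (w : R) (k : int) :
  n.-primitive_root w -> (w ^ k == 1) = (n %| k)%Z.
Proof.
move=> wP; case: (intP k) => [|m|m].
- by rewrite expr0z eqxx dvdz0.
- by rewrite -exprnP -(prim_order_dvd wP) dvdzE.
by rewrite -invr_expz -exprnP invr_eq1 -(prim_order_dvd wP) dvdzE abszN.
Qed.

Lemma prim_root_neq0 (R : fieldType) n (w : R) : n.-primitive_root w -> w != 0.
Proof.
move=> wP; apply/eqP => w0; have /eqP := prim_expr_order wP.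
by rewrite w0 expr0n gtn_eqF ?(prim_order_gt0 wP) // eq_sym oner_eq0.
Qed.

(** * Gauss sums *)

Section GaussSums.
Variables (F : finFieldType) (tau : F -> algC).
Hypothesis tau1 : tau 1 = 1.
Hypothesis tauM : {morph tau : x y / x * y}.
Hypothesis tau_inj : forall x, tau x = 1 -> x = 1.

Local Notation N := #|F|.-1.
Local Notation q := #|F|.

(** Without the case distinction the trivial character, [k = 0], would take the value 1 at 0.
    Integer exponents make inverse characters available; only [k] modulo $q-1$ matters. *)
Definition mchar (k : int) (x : F) : algC := if x == 0 then 0 else tau x ^ k.

Lemma N_gt0 : (0 < N)%N.
Proof. by rewrite -subn1 subn_gt0 finNzRing_gt1. Qed.

Lemma card_NS : q = N.+1.
Proof. by rewrite prednK // (ltn_trans _ (finNzRing_gt1 F)). Qed.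

Lemma expf_N (x : F) : x != 0 -> x ^+ N = 1.
Proof. by move=> x0; apply: (mulfI x0); rewrite -exprS -card_NS expf_card mulr1. Qed.

Lemma tauX x n : tau (x ^+ n) = tau x ^+ n.
Proof. by elim: n => [|n IH]; rewrite ?tau1 // !exprS tauM IH. Qed.

Lemma tau_neq0 x : x != 0 -> tau x != 0.
Proof.
move=> x0; apply/eqP => tx; have := tauM x x^-1.
by rewrite divff // tau1 tx mul0r => /eqP; rewrite oner_eq0.
Qed.

Lemma mcharx0 k : mchar k 0 = 0.
Proof. by rewrite /mchar eqxx. Qed.

Lemma mcharE k x : x != 0 -> mchar k x = tau x ^ k.
Proof. by rewrite /mchar => /negbTE ->. Qed.

Lemma mcharx1 k : mchar k 1 = 1.
Proof. by rewrite mcharE ?oner_neq0 // tau1 exp1rz. Qed.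

Lemma mchar_neq0 k x : x != 0 -> mchar k x != 0.
Proof. by move=> x0; rewrite mcharE // expfz_neq0 // tau_neq0. Qed.

Lemma mcharM k : {morph mchar k : x y / x * y}.
Proof.
move=> x y; rewrite /mchar mulf_eq0; case: eqP => [_|_] /=; first by rewrite mul0r.
by case: eqP => _; rewrite ?mulr0 // tauM expfzMl.
Qed.

Lemma mcharD k l x : mchar (k + l) x = mchar k x * mchar l x.
Proof.
rewrite /mchar; case: eqP => [_|/eqP x0]; first by rewrite mul0r.
by rewrite expfzDr // tau_neq0.
Qed.

Lemma mchar0 x : x != 0 -> mchar 0 x = 1.
Proof. by move=> x0; rewrite mcharE // expr0z. Qed.

Lemma mcharN k x : mchar (- k) x = (mchar k x)^-1.
Proof. by rewrite /mchar; case: eqP; rewrite ?invr0 // invr_expz. Qed.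

Lemma mcharV k x : mchar k x^-1 = (mchar k x)^-1.
Proof.
have [->|x0] := eqVneq x 0; first by rewrite invr0 mcharx0 invr0.
apply: (mulfI (mchar_neq0 k x0)).
by rewrite -mcharM !divff ?mcharx1 ?mchar_neq0.
Qed.

Lemma mcharX k x n : x != 0 -> mchar k (x ^+ n) = mchar k x ^+ n.
Proof.
by move=> x0; elim: n => [|n IH]; rewrite ?mcharx1 // !exprS mcharM IH.
Qed.

Lemma mcharMz k l x : x != 0 -> mchar (k * l) x = mchar k x ^ l.
Proof. by move=> x0; rewrite !mcharE // exprz_exp. Qed.

Lemma tau_expN x : x != 0 -> tau x ^+ N = 1.
Proof. by move=> x0; rewrite -tauX expf_N. Qed.

Lemma mchar_period k j x : mchar (k + N%:Z * j) x = mchar k x.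
Proof.
have [->|x0] := eqVneq x 0; first by rewrite !mcharx0.
by rewrite mcharD mcharMz // (mcharE N%:Z x0) -exprnP tau_expN // exp1rz mulr1.
Qed.

Lemma eq_mchar k l : (N %| k - l)%Z -> mchar k =1 mchar l.
Proof.
move/dvdzP=> [j jE] x; rewrite -(mchar_period l j); congr (mchar _ x).
by rewrite mulrC -jE addrC subrK.
Qed.

Lemma tau_prim_root w : N.-primitive_root w -> N.-primitive_root (tau w).
Proof.
move=> wP; have w0 := prim_root_neq0 wP.
have [m mP mN] := prim_order_exists N_gt0 (tau_expN w0).
suff -> : N = m by [].
apply/eqP; rewrite eqn_dvd mN andbT (prim_order_dvd wP).
by apply/eqP/tau_inj; rewrite tauX prim_expr_order.
Qed.

(** For a nontrivial character, scaling the variable by a generator [w] multiplies the sum by a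
    value other than 1. *)
Lemma sum_mchar k : \sum_x mchar k x = if (N %| k)%Z then N%:R else 0.
Proof.
case: ifP => [/dvdzP[j ->]|kN].
  rewrite (bigD1 0) //= mcharx0 add0r.
  rewrite (eq_bigr (fun=> 1)) => [|x x0]; last first.
    by rewrite mulrC -[_ * j]add0r mchar_period mchar0.
  by rewrite sumr_const; congr (_%:R); rewrite -(cardC1 (0 : F)); apply: eq_card.
have [w wP] := finField_prim_root F.
have w0 := prim_root_neq0 wP.
have kw : mchar k w != 1 by rewrite mcharE // (prim_root_dvdz _ (tau_prim_root wP)) kN.
have : \sum_x mchar k x = mchar k w * \sum_x mchar k x.
  rewrite mulr_sumr (reindex_inj (mulfI w0)).
  by apply: eq_bigr => x _; rewrite mcharM.
move/eqP; rewrite -subr_eq0 -{1}[\sum_x _]mul1r -mulrBl mulf_eq0 subr_eq0 eq_sym.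
by rewrite (negbTE kw) => /eqP.
Qed.

Lemma sum_all_mchar x : \sum_(0 <= k < N) mchar k%:Z x = if x == 1 then N%:R else 0.
Proof.
have [->|x1] := eqVneq x 1.
  under eq_bigr => k _ do rewrite mcharx1.
  by rewrite sumr_const_nat subn0.
have [->|x0] := eqVneq x 0; first by rewrite big1 // => k _; rewrite mcharx0.
under eq_bigr => k _ do rewrite mcharE // -exprnP.
have := subrX1 (tau x) N; rewrite tau_expN // subrr big_mkord => /esym/eqP.
rewrite mulf_eq0 subr_eq0 => /orP[/eqP/tau_inj|/eqP //].
by move/eqP; rewrite (negbTE x1).
Qed.

Variable theta : F -> algC.
Hypothesis theta0 : theta 0 = 1.
Hypothesis thetaD : {morph theta : x y / x + y >-> x * y}.
Hypothesis theta_nontriv : exists x, theta x != 1.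

Lemma sum_theta a : \sum_x theta (a * x) = if a == 0 then q%:R else 0.
Proof.
have [->|a0] := eqVneq a 0.
  by under eq_bigr => x _ do rewrite mul0r theta0; rewrite sumr_const.
have [y y1] := theta_nontriv.
have : \sum_x theta (a * x) = theta y * \sum_x theta (a * x).
  rewrite mulr_sumr (reindex_inj (addrI (y / a))); apply: eq_bigr => x _.
  by rewrite -thetaD mulrDr mulrC divfK.
move/eqP; rewrite -subr_eq0 -{1}[\sum_x _]mul1r -mulrBl mulf_eq0 subr_eq0 eq_sym.
by rewrite (negbTE y1) => /eqP.
Qed.

Definition gauss k := \sum_x mchar k x * theta x.

Lemma eq_gauss k l : (N %| k - l)%Z -> gauss k = gauss l.
Proof. by move/eq_mchar=> e; apply: eq_bigr => x _; rewrite e. Qed.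

Lemma gauss_scale k a : a != 0 ->
  \sum_x mchar k x * theta (a * x) = mchar (- k) a * gauss k.
Proof.
move=> a0; rewrite mulr_sumr (reindex_inj (mulfI (invr_neq0 a0))).
by apply: eq_bigr => x _; rewrite mulVKf // mcharM mcharV mcharN -mulrA.
Qed.

(** The trivial character omits 0, so what remains is the vanishing full sum of [theta] minus
    [theta 0]. *)
Lemma gauss_dvd k : (N %| k)%Z -> gauss k = -1.
Proof.
move=> Nk; rewrite (@eq_gauss _ 0) ?subr0 // /gauss (bigD1 0) //= mcharx0 mul0r add0r.
have := sum_theta 1; rewrite oner_eq0 (bigD1 0) //= mulr0 theta0 => /eqP.
rewrite addrC addr_eq0 => /eqP <-.
by apply: eq_bigr => x x0; rewrite mchar0 // !mul1r.
Qed.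

(** Substituting $x = uy$, the sum of $\theta((1+u)y)$ over $y \ne 0$ is $-1$, plus $q$ when $u =
    -1$. The $-1$ contributes a full character sum, which vanishes. *)
Lemma gauss_mulN k : ~~ (N %| k)%Z -> gauss k * gauss (- k) = mchar k (-1) * q%:R.
Proof.
move=> kN; rewrite [gauss (- k)]/gauss mulr_sumr.
rewrite (bigD1 0) //= mcharx0 mul0r mulr0 add0r.
transitivity (\sum_(y | y != 0) \sum_u mchar k u * theta ((1 + u) * y)).
  apply: eq_bigr => y y0; rewrite mulrA [X in X * _]mulrC -gauss_scale // mulr_suml.
  apply: eq_bigr => u _; rewrite -mulrA -thetaD; congr (_ * theta _); ring.
rewrite exchange_big /=.
transitivity (\sum_u (mchar k u * (if u == -1 then q%:R else 0) - mchar k u)).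
  apply: eq_bigr => u _; rewrite -mulr_sumr -[X in _ - X]mulr1 -mulrBr; congr (_ * _).
  have := sum_theta (1 + u); rewrite addrC addr_eq0 => <-.
  by rewrite [X in _ = X - _](bigD1 0) //= mulr0 theta0 [1 + \sum_(_ | _) _]addrC addrK.
rewrite sumrB sum_mchar (negbTE kN) subr0 (bigD1 (-1)) //= eqxx big1 ?addr0 //.
by move=> u /negbTE ->; rewrite mulr0.
Qed.

Lemma card_neq0 : q%:R != 0 :> algC.
Proof. by rewrite pnatr_eq0 card_NS. Qed.

Lemma gauss_neq0 k : gauss k != 0.
Proof.
have [kN|kN] := boolP (N %| k)%Z; first by rewrite gauss_dvd // oppr_eq0 oner_eq0.
apply/eqP => g0; have /eqP := gauss_mulN kN.
rewrite g0 mul0r eq_sym mulf_eq0 (negbTE card_neq0) orbF => /negPn.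
by rewrite mchar_neq0 // oppr_eq0 oner_eq0.
Qed.

(** Collect the product of the Gauss sums by $s = x + y$ and scale by [s]. The part [s = 0] vanishes
    because the character of exponent [k + l] is nontrivial. *)
Lemma jacobi_gauss k l : ~~ (N %| k + l)%Z ->
  (\sum_x mchar k x * mchar l (1 - x)) * gauss (k + l) = gauss k * gauss l.
Proof.
move=> klN; rewrite [in RHS]/gauss [RHS]mulr_suml.
transitivity (\sum_x \sum_s mchar k x * mchar l (s - x) * theta s); last first.
  apply: eq_bigr => x _; rewrite mulr_sumr [RHS](reindex_inj (addIr (- x))) /=.
  by apply: eq_bigr => s _; rewrite -{2}[s](subrK x) thetaD; ring.
rewrite exchange_big /= mulr_sumr; apply: eq_bigr => s _.
have [->|s0] := eqVneq s 0.
  rewrite mcharx0 mul0r mulr0; under eq_bigr => x _ do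
    rewrite sub0r -[- x]mulN1r mcharM mulrCA -mcharD theta0 mulr1.
  by rewrite -mulr_sumr sum_mchar (negbTE klN) mulr0.
rewrite mulr_suml [RHS](reindex_inj (mulfI s0)); apply: eq_bigr => x _.
have -> : s - s * x = s * (1 - x) by ring.
by rewrite !mcharM mcharD; ring.
Qed.

End GaussSums.

(** * The Hasse-Davenport product formula *)

(** If [m] vanished in [F], so would $q - 1$; but $q$ vanishes there. *)
Lemma natr_dvd_neq0 (F : finFieldType) m : (m %| #|F|.-1)%N -> m%:R != 0 :> F.
Proof.
move=> /dvdnP[e eE]; apply/eqP => m0.
have : #|F|%:R = 0 :> F by rewrite -cardsT -FinRing.zmodXgE expg_cardG ?inE.
rewrite card_NS -natr1 eE natrM m0 mulr0 add0r => /eqP.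
by rewrite oner_eq0.
Qed.

Section HasseDavenport.
Variables (F : finFieldType) (tau : F -> algC).
Hypothesis tau1 : tau 1 = 1.
Hypothesis tauM : {morph tau : x y / x * y}.
Hypothesis tau_inj : forall x, tau x = 1 -> x = 1.
Variable theta : F -> algC.
Hypothesis theta0 : theta 0 = 1.
Hypothesis thetaD : {morph theta : x y / x + y >-> x * y}.
Hypothesis theta_nontriv : exists x, theta x != 1.
Variables (K : finFieldType) (iota : {rmorphism F -> K}) (ell : K -> F).
Hypothesis ellK : cancel iota ell.
Hypothesis ellD : {morph ell : x y / x + y}.
Variable B : nat.
Hypothesis splits : forall f : {poly F}, f \is monic -> (size f <= B.+1)%N ->
  exists rs : seq K, map_poly iota f = \prod_(r <- rs) ('X - r%:P).

Local Notation N := #|F|.-1.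
Local Notation q := #|F|.
Local Notation mchar := (mchar tau).
Local Notation gauss := (gauss tau theta).
Local Notation "f ^i" := (map_poly iota f) (at level 2, format "f ^i").

(** Summing over all of [K] with multiplicities avoids choosing a list of roots and is visibly
    additive on products. *)
Definition root_psum m (f : {poly F}) : K := \sum_(y : K) y ^+ m *+ mup y f^i.

Lemma root_psumE m f rs : f^i = \prod_(r <- rs) ('X - r%:P) ->
  root_psum m f = psum rs m.
Proof.
move=> fE; rewrite /root_psum (eq_bigr (fun y => y ^+ m *+ count_mem y rs)); last first.
  by move=> y _; rewrite fE mu_prod_XsubC.
rewrite /psum; elim: rs {fE} => [|r rs IH] /=; first by rewrite big_nil big1.
rewrite big_cons -IH; under eq_bigr => y _ do rewrite mulrnDr.
rewrite big_split /=; congr (_ + _).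
by rewrite (bigD1 r) //= eqxx big1 ?addr0 // => y /negbTE; rewrite eq_sym => ->.
Qed.

(** The weight $\lambda$ of the L-function: for monic [f] split in [K], the argument of [mchar] is
    the product of the roots. *)
Definition lwt (a : int) m (f : {poly F}) : algC :=
  mchar a ((-1) ^+ (size f).-1 * f`_0) * theta (ell (root_psum m f)).

Lemma lwtM a m f g : f \is monic -> g \is monic ->
  lwt a m (f * g) = lwt a m f * lwt a m g.
Proof.
move=> mf mg; have f0 := monic_neq0 mf; have g0 := monic_neq0 mg.
have szE : (size (f * g)).-1 = ((size f).-1 + (size g).-1)%N.
  rewrite size_monicM //; move: f0 g0; rewrite -!size_poly_gt0.
  by case: (size f) (size g) => [|n] [|k] //= _ _; rewrite addnS.
have pE : root_psum m (f * g) = root_psum m f + root_psum m g.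
  rewrite /root_psum rmorphM /= -big_split; apply: eq_bigr => y _ /=.
  by rewrite mupM ?mulrnDr // map_poly_eq0.
rewrite /lwt szE pE ellD thetaD coef0M exprD.
by rewrite [_ * (f`_0 * _)]mulrACA mcharM //; ring.
Qed.

(** On elements with [y ^+ (q ^ j) = y], [knorm] and [ktrace] are the norm and the trace down to
    [F]. *)
Definition knorm j (y : K) : F := ell (\prod_(i < j) y ^+ (q ^ i)).
Definition ktrace j (y : K) : F := ell (\sum_(i < j) y ^+ (q ^ i)).

Lemma prod_coef0 j y : y ^+ (q ^ j) = y ->
  iota ((-1) ^+ j * (char_poly_at ell j y)`_0) = \prod_(i < j) y ^+ (q ^ i).
Proof.
move=> yj; rewrite rmorphM rmorphXn rmorphN1.
rewrite -(coef_map iota) map_char_poly_at //= /orbit_poly.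
rewrite -(big_map (fun i : 'I_j => y ^+ (q ^ i)) xpredT (fun z => 'X - z%:P)).
rewrite coef0_prod_XsubC size_map /index_enum -enumT size_enum_ord mulrA -exprD addnn.
by rewrite -mul2n exprM sqrrN expr1n expr1n mul1r big_map enumT.
Qed.

Lemma iota_knorm j y : y ^+ (q ^ j) = y -> iota (knorm j y) = \prod_(i < j) y ^+ (q ^ i).
Proof. by move=> yj; rewrite /knorm -prod_coef0 // ellK. Qed.

Lemma lwt_char_poly_at a m j y : y ^+ (q ^ j) = y -> (0 < m)%N ->
  lwt a m (char_poly_at ell j y) = mchar a (knorm j y) * theta (ktrace j (y ^+ m)).
Proof.
move=> yj m0; rewrite /lwt (size_char_poly_at ellK) // /knorm -prod_coef0 // ellK.
congr (_ * theta (ell _)).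
have e : (char_poly_at ell j y)^i
    = \prod_(r <- [seq y ^+ (q ^ (i : 'I_j)) | i <- index_enum 'I_j]) ('X - r%:P).
  by rewrite map_char_poly_at // big_map.
rewrite (root_psumE _ e) /psum big_map; apply: eq_bigr => i _.
by rewrite exprAC.
Qed.

Lemma coef_monic_of n (c : 'rV[F]_n.+1) (i : 'I_n.+1) : (monic_of c)`_i = c 0 i.
Proof. by rewrite coefD coefXn ltn_eqF // add0r coef_rVpoly_ord. Qed.

Lemma ell0 : ell 0 = 0.
Proof. by rewrite -(rmorph0 iota) ellK. Qed.

Lemma lcoef_lwt0 a m : lcoef (lwt a m) 0 = 1.
Proof.
rewrite /lcoef (eq_bigr (fun=> 1)) => [|c _].
  by rewrite sumr_const card_mx.
have -> : monic_of c = 1.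
  rewrite /monic_of expr0 -[RHS]addr0; congr (_ + _).
  by apply/eqP; rewrite -size_poly_leq0 size_rVpoly.
rewrite /lwt size_poly1 coef1 mulr1 mcharx1 // mul1r /root_psum rmorph1.
rewrite big1 ?ell0 // => y _; rewrite mupNroot ?mulr0n //.
by rewrite rootE hornerC oner_eq0.
Qed.

Lemma monic_of_split n (c : 'rV[F]_n) : (n <= B)%N ->
  exists2 rs : seq K, size rs = n & (monic_of c)^i = \prod_(r <- rs) ('X - r%:P).
Proof.
move=> le_nB; have [|rs rsE] := splits (monic_of_monic c).
  by rewrite size_monic_of ltnS.
exists rs => //; apply: succn_inj.
by rewrite -(size_prod_XsubC rs id) -rsE size_map_poly size_monic_of.
Qed.

Lemma esgn_monic_of n (c : 'rV[F]_n.+1) rs : size rs = n.+1 ->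
    (monic_of c)^i = \prod_(r <- rs) ('X - r%:P) ->
  forall j : 'I_n.+1, esgn rs (n.+1 - j) = iota (c 0 j).
Proof.
move=> szrs rsE j; rewrite -coef_prod_XsubC_esgn ?szrs ?leq_subr // -rsE.
by rewrite subKn ?coef_map ?coef_monic_of // ltnW.
Qed.

Lemma ell_psum1 n (c : 'rV[F]_n.+1) : (n < B)%N ->
  ell (root_psum 1 (monic_of c)) = - c 0 ord_max.
Proof.
move=> lt_nB; have [rs szrs rsE] := monic_of_split c lt_nB.
rewrite (root_psumE _ rsE) psum_rec big_geq // subr0 mul1r.
by have := esgn_monic_of szrs rsE ord_max; rewrite /= subSnn => ->; rewrite -rmorphN ellK.
Qed.

Lemma lcoef_lwt1 a : (0 < B)%N -> lcoef (lwt a 1) 1 = gauss a.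
Proof.
move=> B0; rewrite /lcoef (reindex (fun x : F => const_mx (- x) : 'rV[F]_1)); last first.
  exists (fun c : 'rV[F]_1 => - c 0 0) => [x _|c _]; first by rewrite mxE opprK.
  by apply/rowP => i; rewrite mxE opprK ord1.
apply: eq_bigr => x _; rewrite /lwt size_monic_of ell_psum1 // mxE opprK.
by rewrite -[0%N]/(nat_of_ord (ord0 : 'I_1)) coef_monic_of mxE expr1 mulN1r opprK.
Qed.

(** In degree at least 2 the second coefficient can be shifted without touching the constant term.
    The shift by [- y] multiplies the sum by [theta y], which is not 1. *)
Lemma lcoef_lwt_gt1 a n : (n.+1 < B)%N -> lcoef (lwt a 1) n.+2 = 0.
Proof.
move=> ltB; have [y y1] := theta_nontriv.
pose dl : 'rV[F]_n.+2 := - y *: delta_mx 0 ord_max.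
have : lcoef (lwt a 1) n.+2 = theta y * lcoef (lwt a 1) n.+2.
  rewrite {1}/lcoef (reindex_inj (addIr dl)) mulr_sumr; apply: eq_bigr => c _.
  rewrite /lwt !size_monic_of !ell_psum1 // -[0%N]/(nat_of_ord (ord0 : 'I_n.+2)).
  rewrite !coef_monic_of !mxE !eqxx /= mulr0 addr0 mulr1 opprB thetaD; ring.
move/eqP; rewrite -subr_eq0 -{1}[lcoef _ _]mul1r -mulrBl mulf_eq0 subr_eq0 eq_sym.
by rewrite (negbTE y1) => /eqP.
Qed.

Local Notation fsum a m := (frob_sum ell (lwt a m)).

(** The L-function is $1 + g T$, so the recursion reduces to $S_{j+1} = -g S_j$. As $S_j$ is the
    Gauss sum of the lifted characters, this is the Hasse-Davenport lifting relation. *)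
Lemma frob_sum_lwt1 a j : (0 < j <= B)%N -> fsum a 1 j = - (- gauss a) ^+ j.
Proof.
case: j => // j /= le_jB; elim: j le_jB => [|j IH] le_jB.
  have := lcoef_newton ellK splits (@lwtM a 1) le_jB.
  by rewrite big_nat1 lcoef_lwt0 mulr1 mul1r lcoef_lwt1 // expr1 opprK => <-.
have := lcoef_newton ellK splits (@lwtM a 1) le_jB.
rewrite lcoef_lwt_gt1 // mulr0 big_nat_recr //= subnn lcoef_lwt0 mulr1.
rewrite big_nat_recr //= subSnn lcoef_lwt1 ?(leq_trans _ le_jB) // IH 1?ltnW //.
rewrite big1_seq ?add0r => [|i /andP[_]].
  by move/esym/eqP; rewrite addrC addr_eq0 => /eqP ->; rewrite [in RHS]exprS; ring.
rewrite mem_index_iota => /andP[i0 ij].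
have -> : (j.+2 - i)%N = (j - i).+2 by lia.
by rewrite lcoef_lwt_gt1 ?mulr0 //; lia.
Qed.

Lemma knormM j x y : x ^+ (q ^ j) = x -> y ^+ (q ^ j) = y ->
  knorm j (x * y) = knorm j x * knorm j y.
Proof.
move=> xj yj; apply: (fmorph_inj iota).
rewrite rmorphM !iota_knorm // ?exprMn ?xj ?yj // -big_split.
by apply: eq_bigr => i _; rewrite exprMn.
Qed.

Lemma fixX j (x : K) n : x ^+ (q ^ j) = x -> (x ^+ n) ^+ (q ^ j) = x ^+ n.
Proof. by move=> xj; rewrite exprAC xj. Qed.

Lemma knormX j x n : x ^+ (q ^ j) = x -> knorm j (x ^+ n) = knorm j x ^+ n.
Proof.
move=> xj; elim: n => [|n IH]; last by rewrite !exprS knormM ?fixX // IH.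
by apply: (fmorph_inj iota); rewrite iota_knorm ?expr1n // big1 ?rmorph1 // => i _; rewrite expr1n.
Qed.

Lemma knorm_eq0 j y : y ^+ (q ^ j) = y -> (0 < j)%N -> (knorm j y == 0) = (y == 0).
Proof.
move=> yj j0; rewrite -(fmorph_eq0 iota) iota_knorm //.
apply/idP/eqP => [|->].
  by rewrite prodf_seq_eq0 => /hasP[i _ /=]; rewrite expf_eq0 => /andP[_ /eqP].
case: j j0 {yj} => // j _; by rewrite big_ord_recl expn0 expr1 mul0r.
Qed.

(** $X^{q^j-1} - 1$ splits in [K] and is separable, its degree being $-1$ in [K]; its roots form a
    group of full order, hence contain a generator. *)
Lemma exists_prim_root j : (0 < j)%N -> (q ^ j <= B)%N ->
  exists z : K, (q ^ j).-1.-primitive_root z.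
Proof.
move=> j0 le_B; set Q := (q ^ j).-1.
have q1 : (1 < q)%N := finNzRing_gt1 F.
have qj1 : (1 < q ^ j)%N by rewrite -(exp1n j) ltn_exp2r.
have QE : Q.+1 = (q ^ j)%N by rewrite prednK // ltnW.
have Q0 : (0 < Q)%N by rewrite -ltnS QE.
have szf : size ('X^Q - 1 : {poly F}) = Q.+1.
  by rewrite size_polyDl ?size_polyXn // size_polyN size_poly1.
have mf : 'X^Q - 1 \is @monic F by apply: monicXnsubC.
have [|rs rsE] := splits mf; first by rewrite szf QE leqW.
have rsE' : 'X^Q - 1 = \prod_(r <- rs) ('X - r%:P).
  by rewrite -rsE rmorphB /= map_polyXn rmorph1.
have szrs : size rs = Q.
  apply: succn_inj; rewrite -(size_prod_XsubC rs id) -rsE'.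
  by rewrite size_polyDl ?size_polyXn // size_polyN size_poly1.
have rsP : all Q.-unity_root rs.
  by apply/allP => x; rewrite -root_prod_XsubC -rsE'.
have Urs : uniq rs.
  rewrite -separable_prod_XsubC -rsE'; apply: separable_Xn_sub_1.
  have : (q ^ j)%:R = 0 :> K.
    apply/eqP; rewrite natrX expf_eq0 j0 -(rmorph_nat iota) fmorph_eq0 /=.
    by rewrite -cardsT -FinRing.zmodXgE expg_cardG ?inE.
  rewrite -QE -natr1 => /eqP; rewrite addr_eq0 => /eqP ->.
  by rewrite oppr_eq0 oner_eq0.
have /hasP[z _ zP] := has_prim_root Q0 rsP Urs (eq_leq (esym szrs)).
by exists z.
Qed.

(** The norm sends a generator to a generator, so the characters of order dividing [m] composed with
    it detect the [m]-th powers: both sides are [m] or 0. *)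
Lemma count_roots m j x : (m %| N)%N -> (0 < m)%N -> (0 < j)%N -> (q ^ j <= B)%N ->
    x ^+ (q ^ j) = x -> x != 0 ->
  \sum_(i < m) mchar (i%:Z * (N %/ m)%:Z) (knorm j x)
    = #|[pred y : K | (y ^+ (q ^ j) == y) && (y ^+ m == x)]|%:R.
Proof.
move=> mN m0 j0 le_B xj x0.
have nx0 : knorm j x != 0 by rewrite knorm_eq0.
set e := (N %/ m)%N; have Ne : N = (e * m)%N by rewrite divnK.
have [z zP] := exists_prim_root j0 le_B; set Q := (q ^ j).-1 in zP.
have QE : Q.+1 = (q ^ j)%N by rewrite prednK // expn_gt0 card_NS.
have fixE (y : K) : y != 0 -> y ^+ Q = 1 -> y ^+ (q ^ j) = y.
  by move=> y0 yQ; rewrite -QE exprS yQ mulr1.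
have z0 := prim_root_neq0 zP.
have zj : z ^+ (q ^ j) = z by apply: fixE => //; apply: prim_expr_order zP.
pose g := knorm j z.
have gP : N.-primitive_root g.
  rewrite -(fmorph_primitive_root iota) iota_knorm //.
  (* The norm is the power with exponent $r = (q^j-1)/(q-1)$, so its value at [z] has order
     $q-1$. *)
  pose r := (\sum_(i < j) q ^ i)%N.
  have Qr : Q = (N * r)%N by rewrite /Q predn_exp.
  have -> : \prod_(i < j) z ^+ (q ^ i) = z ^+ r by rewrite expr_sum.
  have := exp_prim_root zP r.
  have r0 : (0 < r)%N by move: (prim_order_gt0 zP); rewrite Qr muln_gt0 => /andP[].
  by rewrite Qr gcdnMl mulnK.
have xQ : x ^+ Q = 1 by apply: (mulfI x0); rewrite -exprS QE xj mulr1.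
have [a xE] := prim_rootP zP xQ.
have nxE : knorm j x = g ^+ a by rewrite xE knormX.
pose w := mchar e%:Z (knorm j x).
have -> : \sum_(i < m) mchar (i%:Z * e%:Z) (knorm j x) = \sum_(i < m) w ^+ i.
  by apply: eq_bigr => i _; rewrite mulrC mcharMz.
have w1E : (w == 1) = (m %| a)%N.
  rewrite /w mcharE // -exprnP nxE tauX // -exprM.
  rewrite -(prim_order_dvd (tau_prim_root tau1 tauM tau_inj gP)) Ne mulnC dvdn_pmul2r //.
  by have := N_gt0 F; rewrite Ne muln_gt0 => /andP[].
have [/eqP w1|w1] := boolP (w == 1); last first.
  rewrite [X in X%:R](eq_card0 (A := [pred y | _])) => [|y]; last first.
    rewrite !inE; apply/negP => /andP[/eqP yj /eqP yx]; case/negP: w1.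
    have y0 : y != 0 by apply: contraNneq x0 => y0; rewrite -yx y0 expr0n gtn_eqF.
    rewrite /w -yx knormX // mcharX ?knorm_eq0 // mcharE ?knorm_eq0 //.
    by rewrite -exprnP -exprM -Ne tau_expN ?knorm_eq0.
  have := subrX1 w m.
  have -> : w ^+ m = 1 by rewrite /w mcharE // -exprnP -exprM -Ne tau_expN.
  by rewrite subrr => /esym/eqP; rewrite mulf_eq0 subr_eq0 (negbTE w1) => /eqP.
rewrite (eq_bigr (fun=> 1)) => [|i _]; last by rewrite w1 expr1n.
rewrite sumr_const card_ord; congr (_%:R).
have /dvdnP[c cE] : (m %| a)%N by rewrite -w1E w1.
pose y0 := z ^+ c.
have y0x : y0 ^+ m = x by rewrite /y0 -exprM -cE -xE.
have y0n : y0 != 0 by rewrite expf_neq0.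
have y0j : y0 ^+ (q ^ j) = y0 by apply: fixX.
pose u := iota (g ^+ e).
have uP : m.-primitive_root u.
  rewrite fmorph_primitive_root; have := exp_prim_root gP e.
  have e0 : (0 < e)%N by have := N_gt0 F; rewrite Ne muln_gt0 => /andP[].
  (* The [m]-th roots of unity already lie in [F], so all roots of [y ^+ m = x] are the multiples
     [y0 * u ^+ i]. *)
  by rewrite Ne gcdnMr mulKn.
have uj : u ^+ (q ^ j) = u.
  rewrite /u -rmorphXn; congr (iota _); elim: (j) => [|i IH] //.
  by rewrite expnS exprM expf_card.
have injh : injective (fun i : 'I_m => y0 * u ^+ i).
  move=> i k /(mulfI y0n)/eqP; rewrite (eq_prim_root_expr uP) !modn_small //.
  by move/eqP/val_inj.
rewrite -[LHS]card_ord -(card_codom injh); apply: eq_card => y; rewrite inE.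
apply/codomP/andP => [[i ->]|[/eqP yj /eqP yx]].
  rewrite exprMn y0j fixX // eqxx exprMn y0x -exprM mulnC exprM.
  by rewrite (prim_expr_order uP) expr1n mulr1 eqxx.
have yu : (y / y0) ^+ m = 1 by rewrite expr_div_n yx y0x divff.
by have [i iE] := prim_rootP uP yu; exists i; rewrite -iE mulrC divfK.
Qed.

Lemma mchar_muln m k v : (0 < m)%N -> mchar (m%:Z * k) v = mchar k (v ^+ m).
Proof.
move=> m0; have [->|v0] := eqVneq v 0.
  by rewrite expr0n gtn_eqF // !mcharx0.
by rewrite mulrC mcharMz // mcharX // -exprnP.
Qed.

(** Group the left sum by $x = y^m$: the summand depends only on [x], and [count_roots] writes the
    size of each fibre as a character sum. Over [x = 0] both sides vanish. *)
Lemma frob_sum_pushforward m k j :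
    (m %| N)%N -> (0 < m)%N -> (0 < j)%N -> (q ^ j <= B)%N ->
  fsum (m%:Z * k) m j = \sum_(i < m) fsum (i%:Z * (N %/ m)%:Z + k) 1 j.
Proof.
move=> mN m0 j0 le_B.
pose H x := mchar k (knorm j x) * theta (ktrace j x).
have -> : fsum (m%:Z * k) m j = \sum_(y : K | y ^+ (q ^ j) == y) H (y ^+ m).
  apply: eq_bigr => y /eqP yj; rewrite lwt_char_poly_at // mchar_muln //.
  by rewrite -knormX.
rewrite (partition_big (fun y => y ^+ m) (fun x => x ^+ (q ^ j) == x)) /=; last first.
  by move=> y /eqP yj; rewrite fixX.
rewrite /frob_sum exchange_big /=; apply: eq_bigr => x /eqP xj.
rewrite (eq_bigr (fun=> H x)) => [|y /andP[_ /eqP -> //]].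
have -> : \sum_(i < m) lwt (i%:Z * (N %/ m)%:Z + k) 1 (char_poly_at ell j x)
        = \sum_(i < m) mchar (i%:Z * (N %/ m)%:Z) (knorm j x) * H x.
  apply: eq_bigr => i _; rewrite lwt_char_poly_at // expr1 mcharD // /H; ring.
have [x0|x0] := eqVneq x 0.
  have H0 : H x = 0 by rewrite /H (eqP (_ : knorm j x == 0)) ?mcharx0 ?mul0r // knorm_eq0 // x0.
  by rewrite H0 !big1 // => i _; rewrite mulr0.
by rewrite -[RHS]mulr_suml count_roots // sumr_const mulr_natl.
Qed.

(** By pushforward and lifting, $S_j$ is minus the [j]-th power sum of the negated Gauss sums in
    [rs]. Newton's recursion then makes the [m]-th coefficient their signed top symmetric
    function. *)
Lemma lcoef_lwt_prod m k : (m %| N)%N -> (0 < m)%N -> (q ^ m <= B)%N ->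
  lcoef (lwt (m%:Z * k) m) m = \prod_(i < m) gauss (i%:Z * (N %/ m)%:Z + k).
Proof.
move=> mN m0 le_B; have le_mB : (m <= B)%N.
  by apply: leq_trans le_B; apply/ltnW/ltn_expl/finNzRing_gt1.
pose rs := [seq - gauss (i%:Z * (N %/ m)%:Z + k) | i : 'I_m].
have szrs : size rs = m by rewrite size_map size_enum_ord.
have := @newton_unique _ rs (lcoef (lwt (m%:Z * k) m)) m (lcoef_lwt0 _ _).
move=> /(_ _ m (leqnn m)) ->.
  rewrite -coef_prod_XsubC_esgn ?szrs // subnn coef0_prod_XsubC szrs big_map.
  rewrite big_enum -[m in (-1) ^+ m]card_ord -prodrN /=.
  by apply: eq_bigr => i _; rewrite opprK.
move=> n le_nm.
rewrite (lcoef_newton ellK splits (@lwtM _ m)) ?(leq_trans le_nm) // -sumrN.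
apply: eq_big_nat => j /andP[j0 jn]; rewrite -mulNr; congr (_ * _).
have jB : (q ^ j <= B)%N.
  apply: leq_trans le_B; apply: leq_pexp2l; first exact/ltnW/finNzRing_gt1.
  exact: leq_trans le_nm.
rewrite frob_sum_pushforward // /psum big_map big_enum -sumrN /=.
apply: eq_bigr => i _; rewrite frob_sum_lwt1 // j0 /= (leq_trans _ jB) //.
exact/ltnW/ltn_expl/finNzRing_gt1.
Qed.

(** Separate the constant term [x] from the other coefficients: the power sum is affine in [x] with
    slope [- m.+1%:R], so the sum factors, and the first factor does not involve [a]. *)
Lemma lcoef_lwt_top a m : (m.+1 <= B)%N ->
  lcoef (lwt a m.+1) m.+1 =
    (\sum_(c : 'rV[F]_m.+1 | c 0 0 == 0) theta (ell (root_psum m.+1 (monic_of c))))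
    * \sum_x mchar a ((-1) ^+ m.+1 * x) * theta (- m.+1%:R * x).
Proof.
move=> le_mB; rewrite /lcoef (partition_big (fun c : 'rV_m.+1 => c 0 0) xpredT) //=.
rewrite mulr_sumr; apply: eq_bigr => x _; rewrite mulr_suml.
rewrite (reindex_inj (addIr (x *: delta_mx 0 0))).
apply: eq_big => [c|c]; rewrite !mxE !eqxx mulr1 -subr_eq0 addrK // => /eqP c0.
rewrite /lwt size_monic_of /= -[0%N]/(nat_of_ord (ord0 : 'I_m.+1)) coef_monic_of.
rewrite !mxE !eqxx mulr1 c0 add0r mulrCA; congr (_ * _); rewrite -thetaD; congr (theta _).
have [rs szrs rsE] := monic_of_split c le_mB.
have [ss szss ssE] := monic_of_split (c + x *: delta_mx 0 0) le_mB.
rewrite (root_psumE _ rsE) (root_psumE _ ssE).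
have er := esgn_monic_of szrs rsE; have es := esgn_monic_of szss ssE.
have -> : psum ss m.+1 = psum rs m.+1 - m.+1%:R * (esgn ss m.+1 - esgn rs m.+1).
  apply: psum_esgn_top => -[|n] nm; first by rewrite !esgn0.
  have jm : (m - n < m.+1)%N by rewrite ltnS leq_subr.
  have := er (Ordinal jm); have := es (Ordinal jm); rewrite /=.
  (* The index [m - n] is positive, so this coefficient is unaffected by the change of the constant
     term. *)
  have -> : (m.+1 - (m - n))%N = n.+1 by lia.
  move=> -> ->; rewrite !mxE /= (_ : Ordinal jm == 0 = false) ?mulr0 ?addr0 //.
  by apply/negbTE; rewrite -val_eqE /= -lt0n subn_gt0 -ltnS.
have := er 0; have := es 0; rewrite subn0 => -> ->.
rewrite !mxE !eqxx mulr1 c0 add0r rmorph0 subr0 -mulNr.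
by rewrite -(rmorph_nat iota) -rmorphN -rmorphM ellD ellK.
Qed.

(** Equate the two evaluations of the [m]-th coefficient. Their common factor [C] does not depend on
    the character, so the case [k = 0], where the trivial Gauss sum is -1, computes it. *)
Lemma hasse_davenport_split m k : (m %| N)%N -> (0 < m)%N -> (q ^ m <= B)%N ->
  \prod_(0 <= i < m) gauss (i%:Z * (N %/ m)%:Z + k)
    = mchar (- (m%:Z * k)) m%:R * gauss (m%:Z * k)
      * \prod_(1 <= i < m) gauss (i%:Z * (N %/ m)%:Z).
Proof.
move=> mN m0 le_B; have le_mB : (m <= B)%N.
  by apply: leq_trans le_B; apply/ltnW/ltn_expl/finNzRing_gt1.
have mF := natr_dvd_neq0 mN.
case: m => // m in m0 mN le_B le_mB mF *.
have m1 : (-1) ^+ m.+1 != 0 :> F by rewrite expf_neq0 // oppr_eq0 oner_eq0.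
have mm : - m.+1%:R != 0 :> F by rewrite oppr_eq0.
pose C := \sum_(c : 'rV[F]_m.+1 | c 0 0 == 0) theta (ell (root_psum m.+1 (monic_of c))).
have main l : \prod_(i < m.+1) gauss (i%:Z * (N %/ m.+1)%:Z + l)
    = C * (mchar (- (m.+1%:Z * l)) m.+1%:R * gauss (m.+1%:Z * l)).
  rewrite -lcoef_lwt_prod // lcoef_lwt_top //; congr (_ * _).
  under eq_bigr => x _ do rewrite mcharM // -mulrA.
  rewrite -mulr_sumr gauss_scale // mulrA; congr (_ * _).
  rewrite -[- m.+1%:R]mulN1r mcharM // mulrA -[RHS]mul1r; congr (_ * _).
  rewrite mcharN !mchar_muln // -mcharV // -mcharM //.
  (* The signs collect to a power of -1 with the even exponent $(m+1)(m+2)$. *)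
  rewrite -exprM -exprVn invrN1 -exprD (_ : _ + _ = m.+1 * m.+2)%N; last by lia.
  have : ~~ odd (m.+1 * m.+2)%N by rewrite oddM /=; case: (odd m).
  by move=> /negbTE od; rewrite -signr_odd od mcharx1.
have main0 := main 0; rewrite mulr0 oppr0 mchar0 // mul1r in main0.
have g0 : gauss 0 = -1 by apply: gauss_dvd => //; rewrite dvdz0.
rewrite g0 mulrN1 big_ord_recl mul0r add0r g0 mulN1r in main0.
rewrite big_mkord main mulrC; congr (_ * _); apply: oppr_inj; rewrite -main0.
by rewrite big_add1 big_mkord; congr (- _); apply: eq_bigr => i _; rewrite addr0.
Qed.

End HasseDavenport.

(** Split the product of all monic polynomials of degree [B]. The retraction [ell] is the coordinate
    along 1, an [F]-linear form. *)
Lemma exists_splitting_field (F : finFieldType) B :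
  exists (K : finFieldType) (iota : {rmorphism F -> K}) (ell : K -> F),
  [/\ cancel iota ell, {morph ell : x y / x + y} &
    forall f : {poly F}, f \is monic -> (size f <= B.+1)%N ->
    exists rs : seq K, map_poly iota f = \prod_(r <- rs) ('X - r%:P)].
Proof.
pose p := \prod_(c : 'rV[F]_B) monic_of c.
have p0 : p != 0 by apply/prodf_neq0 => c _; rewrite monic_neq0 ?monic_of_monic.
have [L [rs rsE _]] := FinSplittingFieldFor p0.
pose K : finFieldType := finvect_type L.
pose iota : {rmorphism F -> K} := GRing.in_alg (finvect_type L).
pose X : 1.-tuple L := [tuple 1].
have fX : free X by rewrite seq1_free oner_neq0.
exists K, iota, (fun x : K => coord X 0 (x : L)); split.
- move=> x; rewrite -[iota x]/(x%:A) linearZ /=.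
  by have := coord_free 0 0 fX; rewrite /= => ->; rewrite mulr1.
- by move=> x y; rewrite -[x + y]/((x : L) + (y : L)) linearD.
move=> f mf szf.
have sz0 : (0 < size f)%N by rewrite size_poly_gt0 monic_neq0.
(* Padding by a power of ['X] makes the degree exactly [B], so that [g] is a factor of [p]. *)
pose g := f * 'X^(B.+1 - size f).
have mg : g \is monic by rewrite monicMl // monicXn.
have szg : size g = B.+1.
  rewrite size_monicM ?monic_neq0 ?monicXn // size_polyXn addnS /=.
  by rewrite subnKC.
have dv : f %| p.
  apply: (@dvdp_trans _ g); first by rewrite dvdp_mulr.
  by rewrite -(monic_ofK mg szg) /p (bigD1 (poly_rV (g - 'X^B))) //= dvdp_mulr.
have dvi : map_poly iota f %| \prod_(r <- rs) ('X - r%:P).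
  by rewrite -(eqp_dvdr _ rsE) dvdp_map.
have [m mE] := dvdp_prod_XsubC dvi.
exists (mask m rs); apply/eqP; rewrite -eqp_monic //.
  by rewrite map_monic.
exact: monic_prod_XsubC.
Qed.

Theorem hasse_davenport (F : finFieldType) (tau theta : F -> algC) :
    tau 1 = 1 -> {morph tau : x y / x * y} -> (forall x, tau x = 1 -> x = 1) ->
    theta 0 = 1 -> {morph theta : x y / x + y >-> x * y} ->
    (exists x, theta x != 1) ->
  forall (m : nat) (k : int), (m %| #|F|.-1)%N -> (0 < m)%N ->
  \prod_(0 <= i < m) gauss tau theta (i%:Z * (#|F|.-1 %/ m)%:Z + k)
    = mchar tau (- (m%:Z * k)) m%:R * gauss tau theta (m%:Z * k)
      * \prod_(1 <= i < m) gauss tau theta (i%:Z * (#|F|.-1 %/ m)%:Z).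
Proof.
move=> tau1 tauM tau_inj theta0 thetaD theta_nt m k mN m0.
have [K [iota [ell [ellK ellD splits]]]] := exists_splitting_field F (#|F| ^ m).
exact: (hasse_davenport_split tau1 tauM tau_inj theta0 thetaD theta_nt ellK ellD splits).
Qed.

(** The kernels of the irreducible characters of the additive group meet trivially, so one of them
    misses 1. *)
Lemma exists_additive_character (F : finFieldType) : exists theta : F -> algC,
  [/\ theta 0 = 1, {morph theta : x y / x + y >-> x * y} & exists x, theta x != 1].
Proof.
have [i hi] : exists i : Iirr [set: F]%G, (1 : F) \notin cfker 'chi_i.
  apply/existsP; rewrite -negb_forall; apply/negP => /forallP h.
  have : (1 : F) \in \bigcap_(i : Iirr [set: F]%G) cfker 'chi_i by apply/bigcapP.
  by rewrite TI_cfker_irr inE => /eqP/eqP; rewrite oner_eq0.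
have lin : 'chi_i \is a linear_char.
  by apply/char_abelianP; apply: FinRing.zmod_abelian.
exists 'chi_i; split.
- exact: lin_char1.
- by move=> x y; rewrite -[x + y]/(x * y)%g lin_charM ?inE.
exists 1; apply: contra hi => /eqP e; rewrite cfkerEchar ?irr_char // inE inE.
by rewrite e lin_char1 ?eqxx.
Qed.

(** * The character sum of a trinomial *)

Lemma periodic_sum_shift (G : int -> algC) (M s : nat) :
  (forall k, G (k + M%:Z) = G k) ->
  \sum_(0 <= k < M) G (k%:Z - s%:Z) = \sum_(0 <= k < M) G k%:Z.
Proof.
move=> per; elim: s => [|s IH]; first by apply: eq_bigr => k _; rewrite subr0.
rewrite -{}IH; case: M per => [|M] per; first by rewrite !big_geq.
rewrite big_nat_recl // big_nat_recr //= [LHS]addrC; congr (_ + _).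
  by apply: eq_bigr => k _; congr (G _); lia.
by rewrite -per; congr (G _); lia.
Qed.

Section TrinomialSums.
Variables (F : finFieldType) (tau : F -> algC).
Hypothesis tau1 : tau 1 = 1.
Hypothesis tauM : {morph tau : x y / x * y}.
Hypothesis tau_inj : forall x, tau x = 1 -> x = 1.
Variable theta : F -> algC.
Hypothesis theta0 : theta 0 = 1.
Hypothesis thetaD : {morph theta : x y / x + y >-> x * y}.
Hypothesis theta_nontriv : exists x, theta x != 1.

Local Notation N := #|F|.-1.
Local Notation q := #|F|.
Local Notation mchar := (mchar tau).
Local Notation gauss := (gauss tau theta).

Lemma mchar_even_neg1 k : mchar (2 * k) (-1) = 1.
Proof.
have n1 : -1 != 0 :> F by rewrite oppr_eq0 oner_eq0.
by rewrite mulrC mcharMz // -[2]/(2%:Z) -exprnP -mcharX // sqrrN expr1n mcharx1.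
Qed.

Lemma gauss_prod_opp m M (f : nat -> int) :
  (forall i, (m <= i < M)%N -> ~~ (N %| f i)%Z) ->
  \prod_(m <= i < M) gauss (f i) * \prod_(m <= i < M) gauss (- f i)
    = \prod_(m <= i < M) mchar (f i) (-1) * q%:R ^+ (M - m).
Proof.
move=> fN; rewrite -big_split /= -prodr_const_nat -big_split /=.
by apply: eq_big_nat => i /fN; apply: gauss_mulN.
Qed.

Lemma prod_nat_mirror (R : comNzRingType) (f : nat -> R) m M :
  \prod_(M <= i < M + m) f i = \prod_(0 <= i < m) f (M + m - i.+1)%N.
Proof.
rewrite -{1}[M]add0n big_addn addKn big_nat_rev /= add0n.
by apply: eq_big_nat => i im; congr f; lia.
Qed.

(** Expand the three Gauss sums over $u, v, w$; orthogonality in [k] forces $w = t u^{-n} v^{n+1}$.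
    Here [h] is the exponent of the quadratic character, whose Gauss sum in turn yields the values
    at the trinomial. *)
Lemma trinomial_sum_gauss (h n : nat) (a b : F) : N = (h + h)%N ->
    a != 0 -> b != 0 ->
  N%:R * gauss h * \sum_(x | x != 0) mchar h (x ^+ n.+1 + a * x + b)
  = mchar h b * \sum_(0 <= k < N) mchar k (b ^+ n / a ^+ n.+1)
     * (gauss (h%:Z - n%:Z * k%:Z) * gauss (n.+1%:Z * k%:Z) * gauss (- k%:Z)).
Proof.
move=> Nh a0 b0; set t := b ^+ n / a ^+ n.+1.
have hN : ~~ (N %| h%:Z)%Z.
  have := N_gt0 F; rewrite dvdzE /= Nh => h0; apply/negP => /dvdn_leq; lia.
have hh x : mchar (- h%:Z) x = mchar h x.
  by apply: eq_mchar => //; rewrite Nh; apply/dvdzP; exists (-1); lia.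
have expand k : mchar k t
     * (gauss (h%:Z - n%:Z * k) * gauss (n.+1%:Z * k) * gauss (- k))
   = \sum_u \sum_v \sum_w mchar h u * theta (u + v + w)
       * mchar k (t * (u ^+ n)^-1 * v ^+ n.+1 * w^-1).
  rewrite /gauss big_distrlr /= mulr_suml mulr_sumr; apply: eq_bigr => u _.
  rewrite mulr_suml mulr_sumr; apply: eq_bigr => v _.
  rewrite !mulr_sumr; apply: eq_bigr => w _.
  have [->|u0] := eqVneq u 0; first by rewrite !mcharx0; ring.
  have uE : mchar (n%:Z * k) u = mchar k u ^+ n by rewrite mulrC mcharMz // -exprnP.
  rewrite !mcharD // !mcharM // !mcharV // !mcharN uE mchar_muln // (mcharX _ _ _ _ u0) //.
  by rewrite !thetaD; ring.
rewrite [X in _ = _ * X](eq_bigr _ (fun (k : nat) _ => expand k%:Z)).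
rewrite exchange_big /=.
have inner u : \sum_(0 <= k < N) \sum_v \sum_w mchar h u * theta (u + v + w)
       * mchar k (t * (u ^+ n)^-1 * v ^+ n.+1 * w^-1)
    = N%:R * \sum_(v | v != 0)
        mchar h u * theta (u + v + t * (u ^+ n)^-1 * v ^+ n.+1).
  have [->|u0] := eqVneq u 0.
    rewrite big1 ?big1 ?mulr0 // => [v _|k _]; first by rewrite mcharx0 mul0r.
    by rewrite big1 // => v _; rewrite big1 // => w _; rewrite mcharx0 !mul0r.
  rewrite exchange_big mulr_sumr /= [RHS]big_mkcond /=; apply: eq_bigr => v _.
  rewrite exchange_big /=; under eq_bigr => w _ do rewrite -mulr_sumr sum_all_mchar //.
  case: eqP => [->|/eqP v0].
    by rewrite big1 // => w _; rewrite expr0n mulr0 mul0r eq_sym oner_eq0 mulr0.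
  set w0 := t * (u ^+ n)^-1 * v ^+ n.+1.
  have w0n : w0 != 0.
    by rewrite !mulf_neq0 // ?invr_neq0 // ?expf_neq0 // mulf_neq0 ?invr_neq0 ?expf_neq0.
  rewrite (bigD1 w0) //= divff // eqxx big1 ?addr0 => [|w ww]; first by rewrite mulrC.
  rewrite ifF ?mulr0 //; apply: contraNF ww => /eqP e1.
  have wn : w != 0 by apply/eqP => w00; move/eqP: e1; rewrite w00 invr0 mulr0 eq_sym oner_eq0.
  by rewrite -[w0](divfK wn) e1 mul1r.
rewrite [X in _ = _ * X](eq_bigr _ (fun u _ => inner u)).
rewrite -mulr_sumr mulrCA -mulrA; congr (_ * _).
(* With $u = bz$ and $v = azx$ the forced $w$ is $z x^{n+1}$, so $u + v + w = z(x^{n+1} + ax +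
   b)$. *)
have b1 := mulfI b0.
rewrite mulr_sumr [X in _ = _ * X](reindex_inj b1) /=.
transitivity (\sum_z \sum_(x | x != 0) mchar h z * theta (z * (x ^+ n.+1 + a * x + b))).
  rewrite exchange_big /=; apply: eq_bigr => x x0; set S := _ + b.
  rewrite (eq_bigr (fun z => mchar h z * theta (S * z))) => [|z _]; last by rewrite [z * _]mulrC.
  have [->|S0] := eqVneq S 0; last by rewrite gauss_scale // hh mulrC.
  rewrite mcharx0 mulr0; under eq_bigr => z _ do rewrite mul0r theta0 mulr1.
  by rewrite sum_mchar // (negbTE hN).
rewrite mulr_sumr; apply: eq_bigr => z _.
have [->|z0] := eqVneq z 0.
  by rewrite mulr0 !big1 ?mulr0 // => x _; rewrite mcharx0 mul0r.
have az0 : a * z != 0 by rewrite mulf_neq0.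
rewrite [X in _ = _ * X](reindex_inj (mulfI az0)) /= mulr_sumr.
apply: eq_big => [x|x x0]; first by rewrite mulf_eq0 (negbTE az0).
have bb : mchar h b * mchar h b = 1 by rewrite -{1}hh mcharN mulVf // mchar_neq0.
rewrite mcharM // !mulrA bb mul1r; congr (_ * theta _).
rewrite /t !exprMn !exprS.
have zn : z ^+ n != 0 by rewrite expf_neq0.
have an : a ^+ n != 0 by rewrite expf_neq0.
have bn : b ^+ n != 0 by rewrite expf_neq0.
by field; rewrite zn bn an a0.
Qed.

End TrinomialSums.

(** * The hypergeometric series in terms of Gauss sums *)

Section TrinomialHypergeometric.
Variables (F : finFieldType) (tau : F -> algC).
Hypothesis tau1 : tau 1 = 1.
Hypothesis tauM : {morph tau : x y / x * y}.
Hypothesis tau_inj : forall x, tau x = 1 -> x = 1.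
Variable theta : F -> algC.
Hypothesis theta0 : theta 0 = 1.
Hypothesis thetaD : {morph theta : x y / x + y >-> x * y}.
Hypothesis theta_nontriv : exists x, theta x != 1.

Local Notation N := #|F|.-1.
Local Notation q := #|F|.
Local Notation mchar := (mchar tau).
Local Notation gauss := (gauss tau theta).

(** Dictionary with the theorem: $n = d-1$; the exponents [e], [s], [h] of [tau] give $\xi$, $\psi$
    and the quadratic character $\phi$, since $s = (q-1)/(2(d-1))$ and $h = (q-1)/2$. *)
Variables (r e : nat).
Local Notation n := (2 * r)%N.
Local Notation d := (2 * r).+1.
Local Notation s := (d * e)%N.
Local Notation h := (n * s)%N.
Hypothesis r_gt0 : (0 < r)%N.
Hypothesis NE : N = (2 * d * n * e)%N.

Let e_gt0 : (0 < e)%N.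
Proof. by have := N_gt0 F; rewrite NE; case: (e); rewrite ?muln0. Qed.

Let NdE : N = (d * (2 * n * e))%N. Proof. by rewrite NE; ring. Qed.

Let NnE : N = (n * (2 * s))%N. Proof. by rewrite NE; ring. Qed.

Let Nd : (N %/ d)%N = (2 * n * e)%N.
Proof. by rewrite NdE mulKn. Qed.

Let Nn : (N %/ n)%N = (2 * s)%N.
Proof. by rewrite NnE mulKn // muln_gt0. Qed.

Let dN : (d %| N)%N. Proof. by rewrite NdE dvdn_mulr. Qed.

Let nN : (n %| N)%N. Proof. by rewrite NnE dvdn_mulr. Qed.

Let Nh : N = (h + h)%N. Proof. by rewrite NE; ring. Qed.

Lemma ndvd_odd (v : int) : ~~ (2 %| v)%Z -> ~~ (N %| e%:Z * v)%Z.
Proof.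
apply: contra; rewrite NE => /dvdzP[c cE]; apply/dvdzP; exists (c * (d * n)%N%:Z).
have e0 : e%:Z != 0 by have := e_gt0; lia.
by apply: (mulfI e0); rewrite cE !PoszM; ring.
Qed.

Lemma ndvd_lt (m c i : nat) : N = (m * c)%N -> (0 < i < m)%N ->
  ~~ (N %| i%:Z * c%:Z)%Z.
Proof.
move=> Nmc /andP[i0 im]; have := N_gt0 F; rewrite Nmc muln_gt0 => /andP[m0 c0].
by rewrite -PoszM dvdzE /= dvdn_pmul2r // gtnNdvd.
Qed.

Lemma mchar_prod_even m M (f : nat -> int) :
  \prod_(m <= i < M) mchar (2 * f i) (-1) = 1.
Proof. by rewrite big1 // => i _; rewrite mchar_even_neg1. Qed.

(** As [d] is odd, the nontrivial characters of order dividing [d] form [r] pairs of inverses. They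
    are even powers of [tau], so their value at -1 is 1. *)
Lemma gauss_prod_d : \prod_(1 <= i < d) gauss (i%:Z * (2 * n * e)%N%:Z) = q%:R ^+ r.
Proof.
pose f i := i.+1%:Z * (2 * n * e)%N%:Z.
rewrite big_add1 /= {1}mul2n -addnn (big_cat_nat _ (n := r)) ?leq_addr //=.
rewrite (@prod_nat_mirror _ _ r r).
rewrite [X in _ * X](eq_big_nat _ _ (F2 := fun i => gauss (- f i))); last first.
  move=> i /andP[_ ir]; apply: eq_gauss => //; rewrite /f.
  have -> : (r + r - i.+1).+1%:Z = d%:Z - i.+1%:Z by lia.
  by rewrite opprK -mulrDl subrK -PoszM NE; apply/dvdzP; exists 1; rewrite mul1r; congr Posz; ring.
rewrite gauss_prod_opp // => [|i /andP[_ ir]]; last first.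
  by apply: (@ndvd_lt d); [rewrite NE; ring | lia].
rewrite subn0 (eq_bigr (fun i => mchar (2 * (i.+1%:Z * (n * e)%N%:Z)) (-1))); last first.
  by move=> i _; congr (mchar _ _); rewrite /f !PoszM; ring.
by rewrite mchar_prod_even mul1r.
Qed.

(** The sign $T^{(q-1)/4}(-1)$, as $rs = (q-1)/4$; not the character $\psi$ of the theorem. *)
Let psi := mchar s (-1) ^+ r.

Lemma mchar_even_add (c k : int) : mchar (2 * c + k) (-1) = mchar k (-1).
Proof. by rewrite mcharD // mchar_even_neg1 // mul1r. Qed.

(** These are the denominators of the Jacobi sums. The exponents at [i] and at [n - 1 - i] are
    opposite, and each is an odd multiple of [e], hence nontrivial. *)
Lemma gauss_prod_denom :
  \prod_(0 <= i < n) gauss (i.+1%:Z * (2 * n * e)%N%:Z - s%:Z - (2 * i * s)%N%:Z)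
  = psi * q%:R ^+ r.
Proof.
pose f i := i.+1%:Z * (2 * n * e)%N%:Z - s%:Z - (2 * i * s)%N%:Z.
rewrite -/f {1}mul2n -addnn (big_cat_nat _ (n := r)) ?leq_addr //=.
rewrite (@prod_nat_mirror _ _ r r).
rewrite [X in _ * X](eq_big_nat _ _ (F2 := fun i => gauss (- f i))); last first.
  move=> i /andP[_ ir]; congr (gauss _); rewrite /f.
  have iE : (r + r - i.+1)%N%:Z = n%:Z - i.+1%:Z by lia.
  have -> : (r + r - i.+1).+1%:Z = n%:Z - i%:Z by lia.
  by rewrite !PoszM iE; ring.
have fE i : f i = e%:Z * (2 * (i.+1%:Z * n%:Z - i%:Z * d%:Z) - d%:Z).
  by rewrite /f !PoszM; ring.
rewrite gauss_prod_opp // => [|i _]; last by rewrite -/(f i) fE; apply: ndvd_odd; lia.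
rewrite subn0; congr (_ * _); rewrite /psi.
rewrite (eq_bigr (fun=> mchar s (-1))) ?prodr_const_nat ?subn0 // => i _.
rewrite -(mchar_even_add (i.+1%:Z * (n * e)%N%:Z - i.+1%:Z * s%:Z) s); congr (mchar _ _).
by rewrite /f !PoszM; ring.
Qed.

Lemma gauss_half_sq : gauss h * gauss h = q%:R.
Proof.
have hN : ~~ (N %| h%:Z)%Z.
  have := N_gt0 F; rewrite dvdzE /= Nh => h0; apply/negP => /dvdn_leq; lia.
have {2}-> : gauss h = gauss (- h%:Z).
  by apply: eq_gauss => //; rewrite opprK Nh; apply/dvdzP; exists 1; lia.
rewrite gauss_mulN // (_ : h%:Z = 2 * (r * s)%N%:Z) ?mchar_even_neg1 ?mul1r //.
by rewrite !PoszM; ring.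
Qed.

(** As [n] is even, the middle index [r], the quadratic character, is its own inverse and stays
    outside the [r.-1] pairs. *)
Lemma gauss_prod_n :
  \prod_(1 <= i < n) gauss (i%:Z * (2 * s)%N%:Z) = q%:R ^+ r.-1 * gauss h.
Proof.
pose f i := i.+1%:Z * (2 * s)%N%:Z.
rewrite big_add1 /=.
have -> : (2 * r).-1 = (r.-1.+1 + r.-1)%N by have := r_gt0; lia.
rewrite (big_cat_nat _ (n := r.-1.+1)) ?leq_addr //= big_nat_recr //=.
rewrite (@prod_nat_mirror _ _ r.-1 r.-1.+1).
rewrite [X in _ * _ * X](eq_big_nat _ _ (F2 := fun i => gauss (- f i))); last first.
  move=> i /andP[_ ir]; apply: eq_gauss => //; rewrite /f opprK -mulrDl.
  apply/dvdzP; exists 1; rewrite NnE mul1r [RHS]PoszM; congr (_ * _).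
  by have := r_gt0; lia.
rewrite mulrAC gauss_prod_opp // => [|i /andP[_ ir]]; last first.
  by apply: (@ndvd_lt n) => //; lia.
rewrite subn0 prednK // (_ : r%:Z * (2 * s)%N%:Z = h%:Z); last by rewrite !PoszM; ring.
rewrite (eq_bigr (fun i => mchar (2 * (i.+1%:Z * s%:Z)) (-1))); last first.
  by move=> i _; congr (mchar _ _); rewrite !PoszM; ring.
by rewrite mchar_prod_even mul1r.
Qed.

Lemma gauss_prod_odd :
  \prod_(0 <= i < n) gauss (i%:Z * (2 * s)%N%:Z + s%:Z) = psi * q%:R ^+ r.
Proof.
pose f i := i%:Z * (2 * s)%N%:Z + s%:Z.
rewrite {1}mul2n -addnn (big_cat_nat _ (n := r)) ?leq_addr //=.
rewrite (@prod_nat_mirror _ _ r r).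
rewrite [X in _ * X](eq_big_nat _ _ (F2 := fun i => gauss (- f i))); last first.
  move=> i /andP[_ ir]; apply: eq_gauss => //; rewrite /f opprK.
  have -> : (r + r - i.+1)%N%:Z = n%:Z - i.+1%:Z by lia.
  by apply/dvdzP; exists 1; rewrite NnE !PoszM; ring.
have fE i : f i = e%:Z * (2 * i%:Z * d%:Z + d%:Z) by rewrite /f !PoszM; ring.
rewrite gauss_prod_opp // => [|i _]; last by rewrite -/(f i) fE; apply: ndvd_odd; lia.
rewrite subn0; congr (_ * _); rewrite /psi.
rewrite (eq_bigr (fun=> mchar s (-1))) ?prodr_const_nat ?subn0 // => i _.
rewrite -(mchar_even_add (i%:Z * s%:Z) s); congr (mchar _ _).
by rewrite !PoszM; ring.
Qed.

Let qr0 : q%:R ^+ r != 0 :> algC.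
Proof. by rewrite expf_neq0 // card_neq0. Qed.

Lemma psi_sq : psi * psi = 1.
Proof.
have n1 : -1 != 0 :> F by rewrite oppr_eq0 oner_eq0.
by rewrite /psi -exprMn -mcharM // mulrNN mulr1 mcharx1 // expr1n.
Qed.

Lemma psi_neq0 : psi != 0.
Proof. by apply/eqP => p0; have /eqP := psi_sq; rewrite p0 mul0r eq_sym oner_eq0. Qed.

Lemma psiV : psi^-1 = psi.
Proof. by apply: (mulfI psi_neq0); rewrite psi_sq divff ?psi_neq0. Qed.

(** The product formula for [n] at the character of exponent [s] has every product already evaluated
    except the value $\phi(n)$, which it therefore determines. *)
Lemma mchar_half_n : mchar h n%:R = psi.
Proof.
have := hasse_davenport tau1 tauM tau_inj theta0 thetaD theta_nontriv s nN.
rewrite muln_gt0 r_gt0 /= => /(_ isT); rewrite Nn gauss_prod_odd gauss_prod_n.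
rewrite -PoszM => E; have {}E : psi * q%:R ^+ r = mchar (- h%:Z) n%:R * q%:R ^+ r.
  rewrite E -mulrA; congr (_ * _).
  by rewrite mulrCA gauss_half_sq -exprSr prednK.
by rewrite -[LHS]invrK -mcharN -(mulIf qr0 E) psiV.
Qed.

Definition mbinom (k l : int) :=
  mchar l (-1) / q%:R * \sum_x mchar k x * mchar (- l) (1 - x).

Lemma mbinom_gauss k l : ~~ (N %| k - l)%Z ->
  mbinom k l = mchar l (-1) / q%:R * (gauss k * gauss (- l) / gauss (k - l)).
Proof. by move=> kl; rewrite -jacobi_gauss // mulfK ?gauss_neq0. Qed.

(** Write each Jacobi sum by Gauss sums. The numerators collapse by the product formula for [d] and
    for [n], and the denominators do not depend on [k]. *)
Lemma prod_mbinom k :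
  \prod_(0 <= i < n) mbinom (i.+1%:Z * (2 * n * e)%N%:Z - s%:Z + k) ((2 * i * s)%N%:Z + k)
  = q%:R ^- n * (mchar (- (d%:Z * (k - s%:Z))) d%:R * gauss (d%:Z * (k - s%:Z))
                  * q%:R ^+ r / gauss (k - s%:Z))
    * (mchar (n%:Z * k) n%:R * gauss (- (n%:Z * k)) * (q%:R ^+ r.-1 * gauss h))
    / (psi * q%:R ^+ r).
Proof.
rewrite (eq_bigr (fun i : nat => (mchar k (-1) / q%:R
    * gauss (i.+1%:Z * (2 * n * e)%N%:Z + (k - s%:Z))
    * gauss (- ((2 * i * s)%N%:Z + k))
    * (gauss (i.+1%:Z * (2 * n * e)%N%:Z - s%:Z - (2 * i * s)%N%:Z))^-1))); last first.
  move=> i _.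
  have klE : i.+1%:Z * (2 * n * e)%N%:Z - s%:Z + k - ((2 * i * s)%N%:Z + k)
    = i.+1%:Z * (2 * n * e)%N%:Z - s%:Z - (2 * i * s)%N%:Z by ring.
  rewrite mbinom_gauss klE.
    rewrite (_ : i.+1%:Z * (2 * n * e)%N%:Z - s%:Z + k
               = i.+1%:Z * (2 * n * e)%N%:Z + (k - s%:Z)); last by ring.
    have -> : mchar ((2 * i * s)%N%:Z + k) (-1) = mchar k (-1).
      rewrite -(mchar_even_add (i * s)%N k); congr (mchar _ _).
      by rewrite !PoszM; ring.
    by rewrite !mulrA.
  have -> : i.+1%:Z * (2 * n * e)%N%:Z - s%:Z - (2 * i * s)%N%:Z
     = e%:Z * (2 * (i.+1%:Z * n%:Z - i%:Z * d%:Z) - d%:Z) by rewrite !PoszM; ring.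
  by apply: ndvd_odd; lia.
rewrite !big_split /= !prodfV gauss_prod_denom.
have n1 : -1 != 0 :> F by rewrite oppr_eq0 oner_eq0.
rewrite !prodr_const_nat subn0.
have -> : mchar k (-1) ^+ n = 1.
  by rewrite exprM -mcharX // sqrrN expr1n mcharx1 // expr1n.
(* The product formula for [d] also has the factor of index 0, which is divided out. *)
have A : \prod_(0 <= i < n) gauss (i.+1%:Z * (2 * n * e)%N%:Z + (k - s%:Z))
  = mchar (- (d%:Z * (k - s%:Z))) d%:R * gauss (d%:Z * (k - s%:Z)) * q%:R ^+ r
     / gauss (k - s%:Z).
  have := hasse_davenport tau1 tauM tau_inj theta0 thetaD theta_nontriv (k - s%:Z) dN (ltn0Sn _).
  rewrite Nd gauss_prod_d big_nat_recl // mul0r add0r => <-.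
  by rewrite [gauss (k - _) * _]mulrC mulfK // gauss_neq0.
have Bq : \prod_(0 <= i < n) gauss (- ((2 * i * s)%N%:Z + k))
  = mchar (n%:Z * k) n%:R * gauss (- (n%:Z * k)) * (q%:R ^+ r.-1 * gauss h).
  (* Chosen so that reversing the order of the factors turns [i * 2s + kap] into [- (2is + k)]. *)
  pose kap := - k - (n%:Z - 1) * (2 * s)%N%:Z.
  have := hasse_davenport tau1 tauM tau_inj theta0 thetaD theta_nontriv kap nN.
  rewrite muln_gt0 r_gt0 /= => /(_ isT); rewrite Nn gauss_prod_n.
  have kapE : (N %| n%:Z * kap - (- (n%:Z * k)))%Z.
    apply/dvdzP; exists (1 - n%:Z); rewrite NnE /kap !PoszM; ring.
  have kapE' : (N %| - (n%:Z * kap) - n%:Z * k)%Z.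
    apply/dvdzP; exists (n%:Z - 1); rewrite NnE /kap !PoszM; ring.
  rewrite (eq_mchar tau1 tauM kapE') (eq_gauss tau1 tauM _ kapE) => <-.
  rewrite big_nat_rev /= add0n; apply: eq_big_nat => i /andP[_ ilt].
  congr (gauss _); rewrite /kap.
  have iE : (n - i.+1)%N%:Z = n%:Z - i%:Z - 1 by move: ilt; clear; lia.
  by rewrite !PoszM iE; ring.
by rewrite A Bq mul1r.
Qed.

Section Evaluation.
Variables (a b : F).
Hypotheses (a0 : a != 0) (b0 : b != 0).
Let al : F := d%:R / a * (d%:R * b / (a * n%:R)) ^+ n.
Let t : F := b ^+ n / a ^+ d.

Let d0 : d%:R != 0 :> F. Proof. exact: natr_dvd_neq0. Qed.
Let n0 : n%:R != 0 :> F. Proof. exact: natr_dvd_neq0. Qed.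
Let t0 : t != 0. Proof. by rewrite mulf_neq0 ?invr_neq0 ?expf_neq0. Qed.
Let N1 : -1 != 0 :> F. Proof. by rewrite oppr_eq0 oner_eq0. Qed.

Let alE : - al = -1 * t * d%:R ^+ d / n%:R ^+ n.
Proof.
have an : a ^+ n != 0 by rewrite expf_neq0.
have nn : n%:R ^+ n != 0 :> F by rewrite expf_neq0.
rewrite /al /t !expr_div_n !exprMn !exprS; field.
by rewrite a0 an nn.
Qed.

Let al0 : - al != 0.
Proof. by rewrite alE !mulf_neq0 ?invr_neq0 ?expf_neq0. Qed.

(** [G] is the summand of the trinomial sum, [W] that of the hypergeometric series, where a division
    by [gauss j] replaces [gauss (- j)]. *)
Let G (j : int) := mchar j t * (gauss (h%:Z - n%:Z * j) * gauss (d%:Z * j) * gauss (- j)).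
Let W (j : int) := mchar j (-1) * mchar j t
  * (gauss (h%:Z - n%:Z * j) * gauss (d%:Z * j) / gauss j).

(** After the shift $j = k - s$ the powers of [d] and [n] from the product formulas cancel those in
    $-\alpha$, and the factor at $-1/\alpha$ absorbs the shift. *)
Lemma hyp_term k :
  mchar s (- al^-1) * (\prod_(0 <= i < n) mbinom (i.+1%:Z * (2 * n * e)%N%:Z - s%:Z + k)
      ((2 * i * s)%N%:Z + k) * mchar k (- al))
  = q%:R ^- n * q%:R ^+ r.-1 * gauss h * W (k - s%:Z).
Proof.
set j := k - s%:Z; have kE : k = j + s%:Z by rewrite subrK.
have -> : mchar k (- al) = mchar j (- al) * mchar s (- al) by rewrite -mcharD // subrK.
rewrite prod_mbinom -/j -invrN mcharV //.
have -> : mchar (n%:Z * k) n%:R = mchar j n%:R ^+ n * psi.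
  rewrite kE mulrDr mcharD // -PoszM mchar_half_n; congr (_ * _).
  by rewrite mulrC mcharMz // -exprnP.
have -> : gauss (- (n%:Z * k)) = gauss (h%:Z - n%:Z * j).
  apply: eq_gauss => //; apply/dvdzP; exists (-1); rewrite Nh kE PoszD PoszM; ring.
have -> : mchar (- (d%:Z * j)) d%:R = (mchar j d%:R ^+ d)^-1.
  by rewrite mcharN mulrC mcharMz // -exprnP.
have sal0 : mchar s (- al) != 0 by rewrite mchar_neq0.
have jn0 : mchar j n%:R ^+ n != 0 by rewrite expf_neq0 // mchar_neq0.
have jd0 : mchar j d%:R ^+ d != 0 by rewrite expf_neq0 // mchar_neq0.
have -> : mchar j (- al) = mchar j (-1) * mchar j t * mchar j d%:R ^+ d / mchar j n%:R ^+ n.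
  by rewrite alE; move: (t) => t'; rewrite !mcharM // mcharV // !mcharX.
have := gauss_neq0 tau1 tauM tau_inj theta0 thetaD theta_nontriv j.
rewrite /W; have := psi_neq0; have := qr0.
have qn0 : q%:R ^+ n != 0 :> algC by rewrite expf_neq0 // card_neq0.
move: sal0 jn0 jd0 qn0.
move: (mchar s _) (_ ^+ n) (_ ^+ d) (q%:R ^+ n) (q%:R ^+ r) (q%:R ^+ r.-1) psi (gauss j).
move: (mchar j (-1)) (mchar j t) (gauss h) (gauss _) (gauss _).
move=> x1 x2 x3 x4 x5 x6 x7 x8 x9 x10 x11 x12 x13 h1 h2 h3 h4 h5 h6 h7.
by field; rewrite h1 h2 h3 h4 h5 h6 h7.
Qed.

(** For nontrivial [j] the reflection formula turns $1/g(j)$ into $g(-j)/q$ up to sign. At [j = 0]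
    the Gauss sum is -1 and the difference is $g(h)(1 - 1/q)$. *)
Lemma W_eq (j : nat) : (j < N)%N ->
  W j = q%:R^-1 * G j + (if j == 0%N then gauss h * (N%:R / q%:R) else 0).
Proof.
move=> jN; have q0 := card_neq0 F; case: eqP => [->|/eqP j0].
  have g0 : gauss 0 = -1 by apply: gauss_dvd => //; rewrite dvdz0.
  rewrite /W /G !mchar0 // !mulr0 oppr0 subr0 g0 card_NS -natr1.
  by field; rewrite ?natr1 -card_NS q0.
have jj : ~~ (N %| j%:Z)%Z by rewrite dvdzE /= gtnNdvd // lt0n.
have := gauss_mulN tau1 tauM tau_inj theta0 thetaD theta_nontriv jj.
have gj := gauss_neq0 tau1 tauM tau_inj theta0 thetaD theta_nontriv j.
move=> E; rewrite addr0 /W /G.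
have -> : (gauss j)^-1 = mchar j (-1) * gauss (- j%:Z) / q%:R.
  apply: (mulfI gj); rewrite divff // mulrA mulrCA E mulrA -mcharM // mulrNN mulr1.
  by rewrite mcharx1 // mul1r divff.
have m1 : mchar j (-1) * mchar j (-1) = 1 by rewrite -mcharM // mulrNN mulr1 mcharx1.
transitivity (mchar j (-1) * mchar j (-1) * (q%:R^-1 * (mchar j t *
  (gauss (h%:Z - n%:Z * j) * gauss (d%:Z * j) * gauss (- j%:Z))))); last by rewrite m1 mul1r.
by ring.
Qed.

Lemma W_period (j : int) : W (j + N%:Z) = W j.
Proof.
have dv c : (N %| c * (j + N%:Z) - c * j)%Z by apply/dvdzP; exists c; ring.
have dv1 : (N %| j + N%:Z - j)%Z by apply/dvdzP; exists 1; ring.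
rewrite /W !(eq_mchar tau1 tauM dv1) (eq_gauss tau1 tauM _ (dv d%:Z)).
rewrite (eq_gauss tau1 tauM _ dv1); congr (_ * (_ * _ / _)); apply: eq_gauss => //.
by apply/dvdzP; exists (- n%:Z); ring.
Qed.

Lemma mchar_half_b : mchar h (- (b * n%:R)) * psi = mchar h b.
Proof.
rewrite -mulN1r !mcharM // mchar_half_n -!mulrA psi_sq mulr1.
rewrite (_ : h%:Z = 2 * (r * s)%N%:Z) ?mchar_even_neg1 ?mul1r //.
by rewrite !PoszM; ring.
Qed.

Lemma trinomial_hypergeometric :
  q%:R ^+ r * (mchar h (- (b * n%:R)) * psi) * mchar s (- al^-1)
   * (q%:R / N%:R * \sum_(0 <= k < N)
       (\prod_(0 <= i < n) mbinom (i.+1%:Z * (2 * n * e)%N%:Z - s%:Z + k%:Z)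
          ((2 * i * s)%N%:Z + k%:Z)) * mchar k (- al))
  = \sum_(x | x != 0) mchar h (x ^+ d + a * x + b) + mchar h b.
Proof.
rewrite mchar_half_b; set Sig := \sum_(0 <= k < N) _.
have -> : q%:R ^+ r * mchar h b * mchar s (- al^-1) * (q%:R / N%:R * Sig)
  = q%:R ^+ r * mchar h b * (q%:R / N%:R) * (mchar s (- al^-1) * Sig) by ring.
have {Sig}-> : mchar s (- al^-1) * Sig
    = q%:R ^- n * q%:R ^+ r.-1 * gauss h * \sum_(0 <= k < N) W k.
  rewrite /Sig mulr_sumr -(periodic_sum_shift s W_period) [RHS]mulr_sumr.
  by apply: eq_bigr => k _; apply: hyp_term.
have -> : \sum_(0 <= k < N) W k
    = q%:R^-1 * \sum_(0 <= k < N) G k + gauss h * (N%:R / q%:R).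
  rewrite (eq_big_nat _ _ (F2 := fun k => q%:R^-1 * G k
     + (if k == 0%N then gauss h * (N%:R / q%:R) else 0))); last first.
    by move=> k /andP[_ kN]; apply: W_eq.
  rewrite big_split /= -mulr_sumr; congr (_ + _).
  by rewrite -big_mkcond big_nat1_eq N_gt0.
have := trinomial_sum_gauss tau1 tauM tau_inj theta0 thetaD n Nh a0 b0.
rewrite -/t -/G; set S := \sum_(x | _) _ => E.
have bb : mchar h b * mchar h b = 1.
  rewrite -mcharD // (@eq_mchar _ _ tau1 tauM _ 0) ?mchar0 // subr0.
  by apply/dvdzP; exists 1; rewrite Nh PoszD mul1r.
have -> : \sum_(0 <= k < N) G k = mchar h b * (N%:R * gauss h * S).
  by rewrite E mulrA bb mul1r.
have q0 := card_neq0 F.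
have N0 : N%:R != 0 :> algC by rewrite pnatr_eq0 -lt0n N_gt0.
have -> : q%:R ^+ n = q%:R ^+ r * q%:R ^+ r :> algC by rewrite mul2n -addnn exprD.
have qrE : q%:R ^+ r = q%:R * q%:R ^+ r.-1 :> algC by rewrite -exprS prednK.
have qr1 : q%:R ^+ r.-1 != 0 :> algC by rewrite expf_neq0.
(* The correction at [j = 0] has become the summand [mchar h b]; the remaining Gauss sums cancel as
   $g(h)^2 = q$. *)
transitivity (gauss h * gauss h / q%:R * (mchar h b * mchar h b * S + mchar h b)).
  by rewrite qrE; field; rewrite q0 N0 qr1.
by rewrite gauss_half_sq divff // bb !mul1r.
Qed.

End Evaluation.
End TrinomialHypergeometric.

(** * Characters of the unit group *)

Section CharacterGenerator.
Variables (F : finFieldType) (t : Iirr (UG F)).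
Hypothesis t_gen : forall i : Iirr (UG F), exists k : nat, 'chi_i = 'chi_t ^+ k.

Local Notation N := #|F|.-1.
Local Notation q := #|F|.
Local Notation tau := (ext 'chi_t).
Local Notation mchar := (mchar tau).

Lemma ext0 (chi : 'CF(UG F)) : ext chi 0 = 0.
Proof. by rewrite /ext insubF // unitr0. Qed.

Lemma ext_val (chi : 'CF(UG F)) (u : {unit F}) : ext chi (val u) = chi u.
Proof. by rewrite /ext valK. Qed.

Lemma neq0_val (x : F) : x != 0 -> exists u : {unit F}, x = val u.
Proof. by move=> x0; exists (finField_unit x0). Qed.

Lemma irr_UG_lin (i : Iirr (UG F)) : 'chi_i \is a linear_char.
Proof.
apply/char_abelianP; apply/centsP => u _ v _; apply/val_inj.
exact: mulrC.
Qed.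

Lemma tau_one : tau 1 = 1.
Proof. by rewrite -[1]/(val (1%g : {unit F})) ext_val lin_char1 ?irr_UG_lin. Qed.

Lemma tau_mul : {morph tau : x y / x * y}.
Proof.
move=> x y; have [->|x0] := eqVneq x 0; first by rewrite mul0r ext0 mul0r.
have [->|y0] := eqVneq y 0; first by rewrite mulr0 ext0 mulr0.
have [u ->] := neq0_val x0; have [v ->] := neq0_val y0.
by rewrite -[_ * _ in LHS]/(val (u * v)%g) !ext_val lin_charM ?irr_UG_lin ?inE.
Qed.

Lemma tau_eq1 x : tau x = 1 -> x = 1.
Proof.
have [->|x0] := eqVneq x 0; first by rewrite ext0 => /eqP; rewrite eq_sym oner_eq0.
have [u ->] := neq0_val x0; rewrite ext_val => tu.
suff -> : u = 1%g by [].
apply/set1gP; rewrite -(TI_cfker_irr (UG F)); apply/bigcapP => i _.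
rewrite cfkerEchar ?irr_char // inE inE /= (lin_char1 (irr_UG_lin i)).
by have [k ->] := t_gen i; rewrite exp_cfunE ?inE // tu expr1n.
Qed.

Lemma ext_exp k x : ext ('chi_t ^+ k) x = mchar k x.
Proof.
have [->|x0] := eqVneq x 0; first by rewrite ext0 mcharx0.
rewrite mcharE //; have [u ->] := neq0_val x0.
by rewrite !ext_val exp_cfunE ?inE.
Qed.

Lemma ext_expV k x : ext ('chi_t ^+ k)^-1 x = mchar (- k%:Z) x.
Proof.
rewrite mcharN -ext_exp.
have [->|x0] := eqVneq x 0; first by rewrite !ext0 invr0.
have [u ->] := neq0_val x0; rewrite !ext_val.
have lk : 'chi_t ^+ k \is a linear_char by rewrite rpredX ?irr_UG_lin.
have := congr1 (fun phi : 'CF(UG F) => phi u) (mulVr (lin_char_unitr lk)).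
rewrite cfunE cfun1E in_setT /= => E; apply: (mulIf (lin_char_neq0 lk (in_setT u))).
by rewrite E mulVf // lin_char_neq0 // in_setT.
Qed.

Lemma gbinom_exp k l : gbinom ('chi_t ^+ k) ('chi_t ^+ l) = mbinom tau k l.
Proof.
rewrite /gbinom /mbinom ext_exp; congr (_ * _); apply: eq_bigr => x _.
by rewrite ext_exp ext_expV.
Qed.

(** The powers with exponent below [N] differ at a generator of the unit group, and an abelian group
    has as many irreducible characters as elements. *)
Lemma sum_Iirr_gen (f : 'CF(UG F) -> algC) :
  \sum_(i : Iirr (UG F)) f 'chi_i = \sum_(0 <= k < N) f ('chi_t ^+ k).
Proof.
rewrite big_mkord.
have irr_exp (k : 'I_N) : 'chi_t ^+ k \in irr (UG F).
  by apply: lin_char_irr; rewrite rpredX ?irr_UG_lin.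
pose g (k : 'I_N) := cfIirr ('chi_t ^+ k).
have gE k : 'chi_(g k) = 'chi_t ^+ k by apply: cfIirrE.
have g_inj : injective g.
  move=> k l /(congr1 (fun i => 'chi_i)); rewrite !gE => E.
  have [w wP] := finField_prim_root F.
  have w0 := prim_root_neq0 wP.
  have := congr1 (fun phi => ext phi w) E; rewrite !ext_exp !mcharE // -!exprnP.
  have twP := tau_prim_root tau_one tau_mul tau_eq1 wP.
  move/eqP; rewrite (eq_prim_root_expr twP) !modn_small // => /eqP.
  exact: val_inj.
have g_bij : bijective g.
  apply: inj_card_bij => //; rewrite card_Iirr_abelian.
    by rewrite card_ord card_finField_unit.
  by apply/centsP => u _ v _; apply/val_inj; apply: mulrC.
rewrite (reindex g); last exact: onW_bij.
by apply: eq_bigr => k _; rewrite gE.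
Qed.

(** Squares have value 1. Conversely, if a power of a generator has value 1, its exponent is even
    because [tau] is faithful. *)
Lemma qchar_mchar h x : N = (h + h)%N -> qchar x = mchar h x.
Proof.
move=> Nh; rewrite /qchar; have [->|x0] := eqVneq x 0; first by rewrite mcharx0.
have h2 y : y != 0 -> mchar h (y ^+ 2) = 1.
  move=> y0; rewrite mcharE ?expf_neq0 // -exprnP tauX ?tau_one //; last exact: tau_mul.
  by rewrite -exprM mul2n -addnn -Nh tau_expN //; [exact: tau_one|exact: tau_mul].
case: existsP => [[y /eqP yx]|nsq].
  by rewrite -yx h2 //; apply: contraNneq x0 => y0; rewrite -yx y0 expr0n.
have sq : mchar h x ^+ 2 = 1.
  by rewrite -mcharX ?h2 //; [exact: tau_one|exact: tau_mul].
have : (mchar h x == 1) || (mchar h x == -1) by rewrite -sqrf_eq1 sq.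
case/orP => /eqP // m1; case: nsq.
have [w wP] := finField_prim_root F.
have w0 := prim_root_neq0 wP.
have [a xE] : exists a : nat, x = w ^+ a.
  by have [a xE] := prim_rootP wP (expf_N x0); exists a.
have /eqP := m1; rewrite mcharE // -exprnP xE tauX; [|exact: tau_one|exact: tau_mul].
rewrite -exprM -(prim_order_dvd (tau_prim_root tau_one tau_mul tau_eq1 wP)) Nh addnn -mul2n.
have h0 : (0 < h)%N by have := N_gt0 F; rewrite Nh; case: (h).
rewrite dvdn_pmul2r // => /dvdnP[c cE].
by exists (w ^+ c); rewrite -exprM -cE.
Qed.

End CharacterGenerator.

(** * Counting points and the final identification *)

Lemma card_sqrt (F : finFieldType) (x : F) : 2%:R != 0 :> F ->
  #|[pred y : F | y ^+ 2 == x]|%:R = 1 + qchar x.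
Proof.
move=> two; rewrite /qchar; case: eqP => [->|/eqP x0].
  rewrite addr0 (eq_card (B := pred1 0)) ?card1 // => y; rewrite !inE.
  by rewrite expf_eq0.
case: existsP => [[y /eqP yx]|nsq]; last first.
  rewrite subrr eq_card0 // => y; rewrite inE.
  by apply/negP => yx; apply: nsq; exists y.
have y0 : y != 0 by apply: contraNneq x0 => y0; rewrite -yx y0 expr0n.
rewrite (eq_card (B := pred2 y (- y))) => [|z]; last by rewrite !inE -yx eqf_sqr.
rewrite card2 (_ : y != - y) //; apply/eqP => yy.
have /eqP : 2%:R * y = 0 by rewrite mulr_natl mulr2n {2}yy subrr.
by rewrite mulf_eq0 (negbTE two) (negbTE y0).
Qed.

Lemma Npts_qchar (F : finFieldType) d (a b : F) : 2%:R != 0 :> F -> (0 < d)%N ->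
  (Npts d a b)%:R = #|F|%:R + (\sum_(x | x != 0) qchar (x ^+ d + a * x + b) + qchar b).
Proof.
move=> two d0; pose P (x : F) := x ^+ d + a * x + b.
have -> : (Npts d a b)%:R = \sum_x (1 + qchar (P x)).
  rewrite /Npts -sum1_card natr_sum.
  rewrite (eq_bigl (fun xy : F * F => xpredT xy.1 && (xy.2 ^+ 2 == P xy.1))); last first.
    by move=> xy; rewrite inE.
  rewrite -(pair_big_dep xpredT (fun x y => y ^+ 2 == P x) (fun _ _ => 1%:R)) /=.
  apply: eq_bigr => x _; rewrite -card_sqrt // -sum1_card natr_sum.
  by apply: eq_bigl => y; rewrite inE.
rewrite big_split /= sumr_const; congr (_ + _).
rewrite (bigD1 0) //= addrC; congr (_ + qchar _).
by rewrite /P expr0n gtn_eqF // mulr0 !add0r.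
Qed.

Theorem theorem1p2 (F : finFieldType) (d : nat) (a b : F) (t : Iirr (UG F)) :
  odd d -> (3 <= d)%N ->
  (#|F| == 1 %[mod 2 * d * (d - 1)])%N ->
  a != 0 -> b != 0 ->
  (forall i : Iirr (UG F), exists k : nat, 'chi_i = 'chi_t ^+ k) ->
  let q := #|F| in
  let T := 'chi_t in
  let psi := T ^+ ((q - 1) %/ (2 * (d - 1))) in
  let xi := T ^+ ((q - 1) %/ (2 * d * (d - 1))) in
  let alpha : F := d%:R / a * (d%:R * b / (a * (d - 1)%:R)) ^+ (d - 1) in
  let A := fun k : nat =>
    if k == 0%N then xi ^+ (d - 2) else xi ^+ (2 * k.+1 * (d - 1) - d) in
  let B := fun k : nat => psi ^+ (2 * k) in
  let c := qchar (- (b * (d - 1)%:R)) * ext (T ^+ ((q - 1) %/ 4)) (-1) in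
  (Npts d a b)%:R =
    q%:R + qchar b - c
    + (q ^ ((d - 1) %/ 2))%:R * c
      * ext (T ^+ ((q - 1) %/ (2 * (d - 1)))) (- alpha^-1)
      * ghyp (d - 2) A B (- alpha).
Proof.
move=> odd_d d3 q_mod a0 b0 t_gen.
have [theta [theta0 thetaD theta_nt]] := exists_additive_character F.
have [r dE] : exists r, d = (2 * r).+1.
  by exists d./2; rewrite -[LHS]odd_double_half odd_d add1n mul2n.
move: d3 q_mod odd_d; rewrite {d}dE => r3 q_mod _.
have r0 : (0 < r)%N by lia.
have nE : ((2 * r).+1 - 1 = 2 * r)%N by rewrite subn1.
have [e NE] : exists e, #|F|.-1 = (2 * (2 * r).+1 * (2 * r) * e)%N.
  move: q_mod; rewrite eqn_mod_dvd ?(ltnW (finNzRing_gt1 F)) // !subn1 => /dvdnP[e ->].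
  by exists e; rewrite mulnC.
move: nE; set s := ((2 * r).+1 * e)%N; set n := (2 * r)%N => nE.
have n0 : (0 < n)%N by rewrite muln_gt0.
have e1 : ((#|F| - 1) %/ (2 * n) = s)%N.
  by rewrite subn1 NE (_ : 2 * (2 * r).+1 * (2 * r) * e = 2 * n * s)%N
    ?mulKn ?muln_gt0 // /s /n; ring.
have e2 : ((#|F| - 1) %/ (2 * n.+1 * n) = e)%N by rewrite subn1 NE mulKn ?muln_gt0.
have e3 : ((#|F| - 1) %/ 4 = s * r)%N.
  by rewrite subn1 NE (_ : 2 * (2 * r).+1 * (2 * r) * e = 4 * (s * r))%N ?mulKn // /s; ring.
move=> q T psi xi alpha A B c.
have psiE : psi = T ^+ s by rewrite /psi nE e1.
have xiE : xi = T ^+ e by rewrite /xi nE e2.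
have alE : alpha = n.+1%:R / a * (n.+1%:R * b / (a * n%:R)) ^+ n by rewrite /alpha nE.
have tau1 := tau_one t; have tauM := @tau_mul _ t; have tau_inj := tau_eq1 t_gen.
have Nh : #|F|.-1 = (n * s + n * s)%N by rewrite NE /s /n; ring.
have qE x := qchar_mchar t_gen x Nh.
have two : 2%:R != 0 :> F.
  by apply: natr_dvd_neq0; rewrite NE -!mulnA dvdn_mulr.
have cE : c = mchar (ext T) (n * s)%N (- (b * n%:R)) * mchar (ext T) s (-1) ^+ r.
  rewrite /c nE e3 qE ext_exp; congr (_ * _).
  by rewrite PoszM mcharMz ?oppr_eq0 ?oner_eq0.
(* By [mchar_half_b] the two correction terms of the formula cancel. *)
have cb : c = qchar b.
  by rewrite cE qE; apply: (mchar_half_b tau1 tauM tau_inj theta0 thetaD theta_nt).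
rewrite Npts_qchar // {1}cb addrK; congr (_ + _).
have := trinomial_hypergeometric tau1 tauM tau_inj theta0 thetaD theta_nt r0 NE a0 b0.
rewrite -/n -/s -cE -alE -qE (eq_bigr _ (fun x _ => esym (qE _))) => <-.
rewrite nE e1 natrX mulKn // ext_exp; congr (_ * _).
(* The separate value at [k = 0] fits the general formula, since $2(d-1) - d = d - 2$. *)
have AE k (ltk : (k < n)%N) : A k = T ^+ (e * (2 * k.+1 * n - n.+1)).
  rewrite /A xiE nE; case: k ltk => [|k] ltk /=; rewrite -exprM //.
  by congr (_ ^+ (e * _)); rewrite /n; move: (r); clear; lia.
have BE k : B k = T ^+ (s * (2 * k)) by rewrite /B psiE -exprM.
rewrite /ghyp; congr (_ * _).
rewrite (sum_Iirr_gen t_gen (fun chi => gbinom (A 0%N * chi) chi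
  * (\prod_(1 <= k < (n.+1 - 2).+1) gbinom (A k * chi) (B k * chi)) * ext chi (- alpha))).
apply: eq_bigr => k _; rewrite ext_exp; congr (_ * _).
(* [B 0] is the trivial character, so the leading binomial becomes the factor of index 0 of the
   product. *)
have -> : gbinom (A 0%N * 'chi_t ^+ k) ('chi_t ^+ k)
    = gbinom (A 0%N * 'chi_t ^+ k) (B 0%N * 'chi_t ^+ k) by rewrite BE !muln0 expr0 mul1r.
have -> : (n.+1 - 2).+1 = n by move: r0; rewrite /n; move: (r); clear; lia.
rewrite -(big_ltn (F := fun i => gbinom (A i * 'chi_t ^+ k) (B i * 'chi_t ^+ k))) //.
apply: eq_big_nat => i /andP[_ lti]; rewrite AE // BE -!exprD gbinom_exp.
(* This makes the truncated subtraction in the exponent a true one. *)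
have le_n : (n.+1 <= 2 * i.+1 * n)%N by move: r0; rewrite /n; move: (r) (i); clear; nia.
have aE : (e * (2 * i.+1 * n - n.+1))%N%:Z = i.+1%:Z * (2 * n * e)%N%:Z - s%:Z.
  by rewrite PoszM -(subzn le_n) /s /n !PoszM; ring.
by rewrite !PoszD aE [(s * _)%N]mulnC.
Qed.
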